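(* Let $(R,\mathfrak m)$ be a Cohen-Macaulay local ring of dimension $d\geq 1$ with infinite residue field, let $I$ be an $\mathfrak m$-primary ideal and let $\mathcal F=\{I_n\}_{n\in\mathbb Z}$ be an $I$-admissible filtration of ideals in $R$. Let $H_R(n)=\lambda(I_n/I_{n+1})$ for $n\in\mathbb Z$, and let $P_R(X)\in\mathbb Q[X]$ be the polynomial such that $P_R(n)=H_R(n)$ for all large $n$. Suppose $\operatorname{grade} G(\mathcal F)_+\geq d-1$. Then for a minimal reduction $J=(x_1,\ldots,x_d)$ of $\mathcal F$, $$H_R(r_J(\mathcal F)-d)\neq P_R(r_J(\mathcal F)-d)\quad\text{and}\quad H_R(n)=P_R(n)\ \text{ for all } n\geq r_J(\mathcal F)-d+1.$$
   Context: All rings are commutative with identity; local rings are Noetherian. $\lambda$ denotes length of an $R$-module. Admissible filtration: let $I$ be an $\mathfrak m$-primary ideal of $R$. A family of ideals $\mathcal F=\{I_n\}_{n\in\mathbb Z}$ of $R$ is an $I$-filtration if for all $m,n\in\mathbb Z$: $I^n\subseteq I_n$ (with $I^n=R$ for $n\le 0$); $I_mI_n\subseteq I_{m+n}$; and $I_m\subseteq I_n$ whenever $m\geq n$. It is $I$-admissible if moreover $I_n=I_{\max\{0,n\}}$ for all $n\in\mathbb Z$ (so $I_n=R$ for $n\leq 0$) and the extended Rees ring $\mathcal R'(\mathcal F)=\bigoplus_{n\in\mathbb Z}I_nt^n$ is a finite module over $\mathcal R'(I)=\bigoplus_{n\in\mathbb Z}I^nt^n$, where $t$ is an indeterminate.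 Associated graded ring: $G(\mathcal F)=\bigoplus_{n\geq 0}I_n/I_{n+1}$, and $G(\mathcal F)_+$ is its ideal generated by the homogeneous elements of positive degree; $\operatorname{grade}G(\mathcal F)_+$ is the grade of this ideal in $G(\mathcal F)$ (the maximal length of a $G(\mathcal F)$-regular sequence contained in it). Reductions: a reduction of $\mathcal F$ is an ideal $J\subseteq I_1$ such that $JI_n=I_{n+1}$ for all large $n$; a minimal reduction is a reduction that is minimal with respect to inclusion. For a minimal reduction $J$ of $\mathcal F$, $r_J(\mathcal F)=\min\{m : JI_n=I_{n+1}\text{ for all }n\geq m\}$. *)

(* Defs.v *)
From HB Require Import structures.
From mathcomp Require Import all_boot all_order all_algebra.
From mathcomp Require Import boolp classical_sets functions cardinality fsbigop.

Set Implicit Arguments.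
Unset Strict Implicit.
Unset Printing Implicit Defensive.

Import Order.TTheory GRing.Theory Num.Theory.

Local Open Scope classical_set_scope.
Local Open Scope ring_scope.
Local Open Scope quotient_scope.

(* Ideals and submodules are [Prop]-valued sets: nothing is assumed decidable.
   An ideal of [A] is a submodule of the regular module [A^o]; unlike [idealr]
   of ring_quotient.v, it may be all of [A]. *)

Definition is_submod (R : pzRingType) (M : lmodType R) (N : set M) : Prop :=
  N 0 /\ forall (a : R) (x y : M), N x -> N y -> N (a *: x + y).

Record submodule (R : pzRingType) (M : lmodType R) := Submodule {
  submodule_set :> set M;
  submoduleP : is_submod submodule_set
}.

Definition is_ideal (A : comPzRingType) (a : set A) : Prop :=
  @is_submod A A^o a.

Definition ideal (A : comPzRingType) := @submodule A A^o.

Definition ideal_gen (A : comPzRingType) (X : set A) : set A :=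
  smallest (@is_ideal A) X.

Section SubmoduleTypes.
Variables (R : pzRingType) (M : lmodType R).

Definition submodule_pred (N : submodule M) : {pred M} :=
  fun x => `[< submodule_set N x >].

Lemma submodule_pred_closed (N : submodule M) :
  GRing.submod_closed (submodule_pred N).
Proof.
have [N0 Nlin] := submoduleP N; split; first exact/asboolP.
by move=> a x y /asboolP Nx /asboolP Ny; apply/asboolP; exact: Nlin.
Qed.

HB.instance Definition _ (N : submodule M) :=
  GRing.isSubmodClosed.Build R M (submodule_pred N) (submodule_pred_closed N).

Definition sub_mod (N : submodule M) : Type := {x : M | submodule_pred N x}.

HB.instance Definition _ (N : submodule M) := SubChoice.on (sub_mod N).
HB.instance Definition _ (N : submodule M) :=
  [SubChoice_isSubLmodule of sub_mod N by <:].

Definition quot_mod (N : submodule M) : Type :=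
  Quotient.quot (submodule_pred N).

HB.instance Definition _ (N : submodule M) := GRing.Zmodule.on (quot_mod N).

Section Scaling.
Variable N : submodule M.

Definition quot_mod_proj (x : M) : quot_mod N := \pi_(quot_mod N) x.

Definition quot_scale (a : R) (x : quot_mod N) : quot_mod N :=
  quot_mod_proj (a *: repr x).

Let projE (x y : M) :
  (quot_mod_proj x == quot_mod_proj y) = (x - y \in submodule_pred N).
Proof. by rewrite Quotient.idealrBE. Qed.

Let projD (x y : M) :
  quot_mod_proj (x + y) = quot_mod_proj x + quot_mod_proj y.
Proof. exact: Quotient.pi_add. Qed.

Let projK (x : quot_mod N) : quot_mod_proj (repr x) = x.
Proof. exact: reprK. Qed.

Lemma quot_scaleE (a : R) (x : M) :
  quot_scale a (quot_mod_proj x) = quot_mod_proj (a *: x).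
Proof.
by apply/eqP; rewrite /quot_scale projE -scalerBr rpredZ // -projE projK.
Qed.

Lemma quot_scaleA (a b : R) (x : quot_mod N) :
  quot_scale a (quot_scale b x) = quot_scale (a * b) x.
Proof. by rewrite -[x]projK !quot_scaleE scalerA. Qed.

Lemma quot_scale1 : left_id 1 quot_scale.
Proof. by move=> x; rewrite -[x]projK quot_scaleE scale1r. Qed.

Lemma quot_scaleDr : right_distributive quot_scale +%R.
Proof.
move=> a x y; rewrite -[x]projK -[y]projK -projD !quot_scaleE.
by rewrite scalerDr projD.
Qed.

Lemma quot_scaleDl (x : quot_mod N) : {morph quot_scale^~ x : a b / a + b}.
Proof.
by move=> a b; rewrite -[x]projK !quot_scaleE scalerDl projD.
Qed.

HB.instance Definition _ := GRing.Zmodule_isLmodule.Build R (quot_mod N)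
  quot_scaleA quot_scale1 quot_scaleDr quot_scaleDl.

End Scaling.
End SubmoduleTypes.

(* The submodule [N :&: N'] of [N], so that
   [quot_mod (restrict_submod N N')] is [N / N'] when [N'] is contained in [N]. *)
Lemma is_submod_restrict (R : pzRingType) (M : lmodType R)
  (N N' : submodule M) :
  is_submod [set x : sub_mod N | submodule_set N' (val x)].
Proof.
have [N'0 N'lin] := submoduleP N'; split; first by rewrite /mkset raddf0.
by move=> a x y N'x N'y; rewrite /mkset linearP; exact: N'lin.
Qed.

Definition restrict_submod (R : pzRingType) (M : lmodType R)
  (N N' : submodule M) : submodule (sub_mod N) :=
  Submodule (is_submod_restrict N N').

Section QuotientRing.
Variables (A : comPzRingType) (a : ideal A).

Definition quot_ring : Type := Quotient.quot (submodule_pred a).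

HB.instance Definition _ := GRing.Zmodule.on quot_ring.

Definition quot_ring_proj (x : A) : quot_ring := \pi_quot_ring x.

Definition quot_mul (x y : quot_ring) : quot_ring :=
  quot_ring_proj (repr x * repr y).

Let projE (x y : A) :
  (quot_ring_proj x == quot_ring_proj y) = ((x - y : A^o) \in submodule_pred a).
Proof. by rewrite Quotient.idealrBE. Qed.

Let projD (x y : A) : quot_ring_proj (x + y) = quot_ring_proj x + quot_ring_proj y.
Proof. exact: Quotient.pi_add. Qed.

Let projK (x : quot_ring) : quot_ring_proj (repr x) = x.
Proof. exact: reprK. Qed.

Lemma quot_mulE (x y : A) :
  quot_mul (quot_ring_proj x) (quot_ring_proj y) = quot_ring_proj (x * y).
Proof.
set x' := repr (quot_ring_proj x); set y' := repr (quot_ring_proj y).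
apply/eqP; rewrite /quot_mul projE -/x' -/y'.
have hx : (x' - x : A^o) \in submodule_pred a by rewrite -projE projK.
have hy : (y' - y : A^o) \in submodule_pred a by rewrite -projE projK.
have -> : x' * y' - x * y = x' *: (y' - y : A^o) + y *: (x' - x : A^o).
  rewrite /GRing.scale /= !mulrBr [y * x']mulrC [y * x]mulrC.
  by rewrite addrA subrK.
by rewrite rpredD // rpredZ.
Qed.

Lemma quot_mulA : associative quot_mul.
Proof.
move=> x y z; rewrite -[x]projK -[y]projK -[z]projK.
by rewrite !quot_mulE mulrA.
Qed.

Lemma quot_mulC : commutative quot_mul.
Proof. by move=> x y; rewrite /quot_mul mulrC. Qed.

Lemma quot_mul1 : left_id (quot_ring_proj 1) quot_mul.
Proof. by move=> x; rewrite -[x]projK quot_mulE mul1r. Qed.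

Lemma quot_mulDl : left_distributive quot_mul +%R.
Proof.
move=> x y z; rewrite -[x]projK -[y]projK -[z]projK.
by rewrite -projD !quot_mulE mulrDl projD.
Qed.

HB.instance Definition _ := GRing.Zmodule_isComPzRing.Build quot_ring
  quot_mulA quot_mulC quot_mul1 quot_mulDl.

End QuotientRing.

Definition chain_of (T : Type) (S : set (set T)) (n : nat) : Prop :=
  exists L : 'I_n.+1 -> set T,
    (forall i, S (L i)) /\ (forall i j : 'I_n.+1, (i < j)%N -> L i `<` L j).

Definition max_chain_length (T : Type) (S : set (set T)) (n : nat) : Prop :=
  chain_of S n /\ forall k, chain_of S k -> (k <= n)%N.

(* 0 when the length is infinite *)
Definition mod_length (R : pzRingType) (M : lmodType R) : nat :=
  xget 0%N (max_chain_length (@is_submod R M)).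

Section CommutativeAlgebra.
Variable A : comPzRingType.
Implicit Types (a b p q X : set A) (s : seq A).

Definition is_prime p : Prop :=
  [/\ is_ideal p, ~ p 1 & forall x y, p (x * y) -> p x \/ p y].

Definition is_maximal a : Prop :=
  [/\ is_ideal a, ~ a 1 &
      forall b, is_ideal b -> a `<=` b -> b = a \/ b = setT].

Definition noetherian : Prop :=
  forall a, is_ideal a -> exists s, a = ideal_gen [set` s].

Definition local_ring a : Prop :=
  [/\ noetherian, is_maximal a & forall b, is_maximal b -> b = a].

Definition krull_dim (d : nat) : Prop := max_chain_length is_prime d.

Definition radical a : set A := [set x | exists n : nat, a (x ^+ n)].

Definition is_primary q : Prop :=
  [/\ is_ideal q, ~ q 1 &
      forall x y, q (x * y) -> q x \/ exists n : nat, q (y ^+ n)].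

Definition primary_to p q : Prop := is_primary q /\ radical q = p.

Definition regular_seq s : Prop :=
  (forall i, (i < size s)%N ->
     forall y, ideal_gen [set` take i s] (s`_i * y) ->
               ideal_gen [set` take i s] y) /\
  ~ ideal_gen [set` s] 1.

Definition regular_seq_in a (n : nat) : Prop :=
  exists s, [/\ regular_seq s, [set` s] `<=` a & size s = n].

Definition is_grade a (g : nat) : Prop :=
  regular_seq_in a g /\ forall n, regular_seq_in a n -> (n <= g)%N.

(* depth equals dimension, for a local ring with maximal ideal [a] *)
Definition cohen_macaulay a : Prop := exists d, krull_dim d /\ is_grade a d.

Definition ideal_mul a b : set A :=
  ideal_gen [set z | exists x y, [/\ a x, b y & z = x * y]].

Definition ideal_expz a (n : int) : set A :=
  match n with
  | Posz k => iter k (ideal_mul a) setT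
  | Negz _ => setT
  end.

End CommutativeAlgebra.

Record filtration (R : comNzRingType) (I : set R) := Filtration {
  fil :> int -> set R;
  fil_ideal : forall n, is_ideal (fil n);
  fil_exp : forall n, ideal_expz I n `<=` fil n;
  fil_mul : forall m n, ideal_mul (fil m) (fil n) `<=` fil (m + n);
  fil_anti : forall m n, (n <= m)%R -> fil m `<=` fil n
}.

(* Elements of the extended Rees ring of the family [K] are represented as
   Laurent polynomials over [R], i.e. finitely supported functions on [int]
   (the value at [n] is the coefficient of [t^n]), with product [laurent_mul]. *)
Definition ext_rees (R : comNzRingType) (K : int -> set R) : set (int -> R) :=
  [set f | finite_set [set n | f n <> 0] /\ forall n, K n (f n)].

Definition laurent_mul (R : comNzRingType) (f g : int -> R) : int -> R :=
  fun n => \sum_(i \in [set: int]) (f i * g (n - i)).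

(* [ext_rees K'] is a finite module over [ext_rees K] *)
Definition ext_rees_finite (R : comNzRingType) (K K' : int -> set R) : Prop :=
  exists (k : nat) (f : 'I_k -> int -> R),
    (forall j, ext_rees K' (f j)) /\
    forall h, ext_rees K' h ->
      exists g : 'I_k -> int -> R,
        (forall j, ext_rees K (g j)) /\
        forall n, h n = \sum_(j < k) laurent_mul (g j) (f j) n.

Definition admissible (R : comNzRingType) (I : set R) (F : filtration I) :
    Prop :=
  (forall n : int, F n = F (Num.max 0 n)) /\
  ext_rees_finite (ideal_expz I) F.

Section Filtrations.
Variables (R : comNzRingType) (I : set R) (F : filtration I).

Definition fil_submod (n : int) : ideal R := Submodule (fil_ideal F n).

Definition gr_piece (n : int) : lmodType R :=
  quot_mod (restrict_submod (fil_submod n) (fil_submod (n + 1))).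

Definition hilbert_fun (n : int) : nat := mod_length (gr_piece n).

Lemma filM m n x y : F m x -> F n y -> F (m + n) (x * y).
Proof.
by move=> Fx Fy; apply: fil_mul => B [_]; apply; exists x, y.
Qed.

Lemma fil0 n : F n 0. Proof. by have [] := fil_ideal F n. Qed.

Lemma filD n x y : F n x -> F n y -> F n (x + y).
Proof.
by move=> Fx Fy; have [_ /(_ 1 x y Fx Fy)] := fil_ideal F n; rewrite scale1r.
Qed.

Lemma filN n x : F n x -> F n (- x).
Proof.
move=> Fx; have [_ /(_ (-1) x 0 Fx (fil0 n))] := fil_ideal F n.
by rewrite addr0 scaleN1r.
Qed.

Lemma fil_sum n (T : Type) (r : seq T) (P : pred T) (f : T -> R) :
  (forall i, P i -> F n (f i)) -> F n (\sum_(i <- r | P i) f i).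
Proof. by move=> Ff; apply: big_ind => //; [exact: fil0 | exact: filD]. Qed.

(* Membership in the Rees algebra [\bigoplus_(n >= 0) I_n t^n] inside [R[t]] *)
Definition rees_pred : {pred {poly R}} :=
  fun p => `[< forall n : nat, F n%:Z p`_n >].

Lemma rees_pred_closed : GRing.subring_closed rees_pred.
Proof.
split.
- apply/asboolP => n; rewrite coef1; case: n => [|n] /=; last exact: fil0.
  exact: (@fil_exp _ _ F 0).
- move=> p q /asboolP Fp /asboolP Fq; apply/asboolP => n.
  by rewrite coefB; apply: filD => //; exact: filN.
- move=> p q /asboolP Fp /asboolP Fq; apply/asboolP => n.
  rewrite coefM; apply: fil_sum => i _.
  by have := filM (Fp i) (Fq (n - i)%N); rewrite -PoszD subnKC // -ltnS.
Qed.

HB.instance Definition _ :=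
  GRing.isSubringClosed.Build {poly R} rees_pred rees_pred_closed.

Definition rees : Type := {p : {poly R} | rees_pred p}.

HB.instance Definition _ := SubChoice.on rees.
HB.instance Definition _ := [SubChoice_isSubComNzRing of rees by <:].

Definition rees_shift : set rees :=
  [set p : rees | forall n : nat, F n.+1%:Z (val p : {poly R})`_n].

Lemma rees_shift_ideal : is_ideal rees_shift.
Proof.
split; first by move=> n; rewrite raddf0 coef0; exact: fil0.
move=> a x y Fx Fy n.
have -> : val (a *: x + y : rees^o) = (val a : {poly R}) * val x + val y by [].
rewrite coefD; apply: filD (Fy n).
rewrite coefM; apply: fil_sum => i _.
have /asboolP Fa := valP a.
have := filM (Fa i) (Fx (n - i)%N).
by rewrite -PoszD addnS subnKC // -ltnS.
Qed.

(* [G(F) = \bigoplus_(n >= 0) I_n / I_(n+1)], as the quotient of the Rees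
   algebra [\bigoplus_(n >= 0) I_n t^n] by [\bigoplus_(n >= 0) I_(n+1) t^n] *)
Definition assoc_gr : comPzRingType := quot_ring (Submodule rees_shift_ideal).

Definition gr_proj (p : rees) : assoc_gr := quot_ring_proj _ p.

Definition gr_homogeneous (n : nat) : set assoc_gr :=
  [set z | exists (p : rees) (x : R), val p = x *: 'X^n /\ z = gr_proj p].

Definition gr_plus : set assoc_gr :=
  ideal_gen [set z | exists2 n : nat, (0 < n)%N & gr_homogeneous n z].

Definition is_reduction (J : set R) : Prop :=
  [/\ is_ideal J, J `<=` F 1 &
      exists N : int, forall n : int, (N <= n)%R ->
        ideal_mul J (F n) = F (n + 1)].

Definition is_minimal_reduction (J : set R) : Prop :=
  is_reduction J /\ forall J', is_reduction J' -> J' `<=` J -> J' = J.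

Definition is_reduction_number (J : set R) (r : int) : Prop :=
  let stable m := forall n : int, (m <= n)%R -> ideal_mul J (F n) = F (n + 1) in
  stable r /\ forall m : int, stable m -> (r <= m)%R.

Definition is_hilbert_poly (P : {poly rat}) : Prop :=
  exists N : int, forall n : int, (N <= n)%R ->
    P.[n%:~R] = (hilbert_fun n)%:R.

End Filtrations.

Arguments assoc_gr {R I} F.
Arguments gr_proj {R I} F p.
Arguments gr_homogeneous {R I} F n _.
Arguments gr_plus {R I} F _.

(* Main.v *)
(** Let K(n) be the degree n strand of the Koszul complex of the classes of
    x_1, ..., x_d in G(F)_1.  Its Euler characteristic is
    sum_i (-1)^i C(d,i) H_R(n - i), the d-th difference of H_R.

    By depth sensitivity of Koszul homology, grade G(F)_+ >= d - 1 leaves only H_0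
    and H_1 of K(n), and Cohen-Macaulayness kills H_i(x_1, ..., x_d; R) for i > 0.
    No generic choice of generators of J is needed: it is enough that every element
    of G(F)_+ (resp. of m) has a power in the ideal generated by the classes of the
    x_j (resp. by the x_j).  For n >= r = r_J(F) one has I_(n+1) = J I_n, so a cycle
    representing a class of H_1(K(n)) lifts to a cycle over R, which is a boundary;
    the acyclicity of G(F) in degrees >= 2 makes it the boundary of an element of
    the right filtration degree, so H_1(K(n)) = 0.  Finally
    H_0(K(n)) = I_n / (J I_(n-1) + I_(n+1)) vanishes for n > r but not for n = r,
    since I_(r+1) = J I_r is contained in J I_(r-1).

    Hence the d-th difference of H_R - P_R vanishes at n > r and not at n = r;
    as H_R - P_R is eventually zero, descending on n gives the theorem. *)

Require Import Defs.
From HB Require Import structures.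
From mathcomp Require Import all_boot all_order all_algebra.
From mathcomp Require Import ring zify.
From mathcomp Require Import boolp classical_sets functions cardinality fsbigop.

Set Implicit Arguments.
Unset Strict Implicit.
Unset Printing Implicit Defensive.

Import Order.TTheory GRing.Theory Num.Theory.

Local Open Scope classical_set_scope.
Local Open Scope ring_scope.

(** * Submodules and ideals *)

Section Submodules.
Variables (R : pzRingType) (M : lmodType R) (N : set M).
Hypothesis subN : is_submod N.

Lemma submod0 : N 0. Proof. by case: subN. Qed.

Lemma submodD u v : N u -> N v -> N (u + v).
Proof. by move=> Nu Nv; have := subN.2 1 u v Nu Nv; rewrite scale1r. Qed.

Lemma submodZ c u : N u -> N (c *: u).
Proof. by move=> Nu; have := subN.2 c u 0 Nu submod0; rewrite addr0. Qed.

Lemma submodN u : N u -> N (- u).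
Proof. by move=> Nu; rewrite -scaleN1r; apply: submodZ. Qed.

Lemma submodB u v : N u -> N v -> N (u - v).
Proof. by move=> Nu Nv; apply: submodD => //; apply: submodN. Qed.

Lemma submod_sum (T : Type) (s : seq T) (Q : pred T) (f : T -> M) :
  (forall i, Q i -> N (f i)) -> N (\sum_(i <- s | Q i) f i).
Proof. by move=> Nf; apply: big_ind => //; [exact: submod0 | exact: submodD]. Qed.

End Submodules.

Section Ideals.
Variable A : comPzRingType.
Implicit Types (b : set A) (s : seq A).

Lemma idealM b : is_ideal b -> forall c y, b y -> b (c * y).
Proof. by move=> ib; exact: (submodZ ib). Qed.

Lemma ideal_gen_ideal (X : set A) : is_ideal (ideal_gen X).
Proof.
split=> [|c y z yX zX] B [iB XB]; first by case: iB.
by apply: iB.2; [apply: yX | apply: zX].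
Qed.

Lemma ideal_gen_sub (X : set A) : X `<=` ideal_gen X.
Proof. by move=> y Xy B [_]; apply. Qed.

Lemma ideal_gen_min (X b : set A) : is_ideal b -> X `<=` b -> ideal_gen X `<=` b.
Proof. by move=> ib Xb y; apply. Qed.

Lemma ideal_gen_nil : ideal_gen [set` [::]] = [set 0 : A].
Proof.
apply/seteqP; split=> [|_ ->]; last exact: (submod0 (ideal_gen_ideal _)).
apply: ideal_gen_min => //; split=> [//|c _ _ -> ->] /=.
by rewrite scaler0 addr0.
Qed.

(** Presents the quotient by one more element of a sequence as the quotient modulo [z] of the
    previous one, which is the induction step along a regular sequence. *)
Lemma ideal_gen_rcons s z y :
  ideal_gen [set` rcons s z] y <-> exists q, ideal_gen [set` s] (y - z * q).
Proof.
have iS := ideal_gen_ideal [set` s]; have iz := ideal_gen_ideal [set` rcons s z].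
split=> [|[q sq]].
  apply: (@ideal_gen_min _ [set y | exists q, ideal_gen [set` s] (y - z * q)]).
    split=> [|c u v [p up] [q vq]].
      by exists 0; rewrite mulr0 subr0; exact: (submod0 iS).
    exists (c * p + q).
    have -> : (c *: (u : A^o) + v - z * (c * p + q) =
               c *: (u - z * p : A^o) + (v - z * q)).
      by rewrite /GRing.scale /=; ring.
    exact: iS.2.
  move=> u /=; rewrite mem_rcons inE => /orP[/eqP->|us].
    by exists 1; rewrite mulr1 subrr; exact: (submod0 iS).
  by exists 0; rewrite mulr0 subr0; exact: ideal_gen_sub.
rewrite -[y](subrK (z * q)); apply: (submodD iz).
  apply: ideal_gen_min sq => // u us; apply: ideal_gen_sub => /=.
  by rewrite mem_rcons inE us orbT.
rewrite mulrC; apply: (idealM iz); apply: ideal_gen_sub => /=.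
by rewrite mem_rcons inE eqxx.
Qed.

End Ideals.
(** * Lengths of subquotients *)

Section Chains.
Variable T : Type.
Implicit Types (S : set (set T)) (X Y : set T).

Lemma proper_sub_trans X Y (Z : set T) : X `<` Y -> Y `<=` Z -> X `<` Z.
Proof.
by move=> [XY nYX] YZ; split=> [y /XY/YZ//|ZX]; apply: nYX => y /YZ/ZX.
Qed.

(** Strict chains of length [n] that end at the indexed set. Recording the top term makes chains
    amenable to induction, unlike the functions on ordinals in [chain_of]. *)
Inductive chain_to S : nat -> set T -> Prop :=
| chain_to0 X : S X -> chain_to S 0 X
| chain_toS n X Y : chain_to S n X -> S Y -> X `<` Y -> chain_to S n.+1 Y.

Lemma chain_to_last S n X : chain_to S n X -> S X.
Proof. by case. Qed.

(** Only the top term is exchanged; enlarging it keeps the last inclusion strict. *)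
Lemma chain_to_le S n X Y : chain_to S n X -> S Y -> X `<=` Y -> chain_to S n Y.
Proof.
case=> [{}X _ SY _|{}n {}X Z chX SZ XZ SY ZY]; first exact: chain_to0.
by apply: chain_toS chX SY _; exact: proper_sub_trans XZ ZY.
Qed.

Lemma chain_ofP S n : chain_of S n <-> exists X, chain_to S n X.
Proof.
split=> [[L [SL ltL]]|[X chX]].
  have main : forall k, (k <= n)%N -> chain_to S k (L (inord k)).
    elim=> [_|k IH kn]; first by apply: chain_to0; exact: SL _.
    apply: chain_toS (IH (ltnW kn)) (SL _) _; apply: ltL.
    by rewrite !inordK // ltnW.
  by exists (L (inord n)); exact: main.
suff [L [SL ltL _]] : exists L : nat -> set T, [/\ forall i, S (L i),
    forall i j, (i < j <= n)%N -> L i `<` L j & L n = X].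
  by exists (fun i => L i); split=> // i j ij; apply: ltL; rewrite ij -ltnS /=.
elim: chX => [{}X SX|{}n {}X Y _ [L [SL ltL LX]] SY XY].
  by exists (fun=> X); split=> // i [|j] /andP[].
exists (fun i => if (i <= n)%N then L i else Y); split=> [i|i j /andP[ij jn]|].
- by case: ifP.
- have [jn'|jn'] := leqP j n.
    by rewrite (leq_trans (ltnW ij) jn'); apply: ltL; rewrite ij.
  have in' : (i <= n)%N by rewrite -ltnS (leq_trans ij jn).
  rewrite in'; move: in'; rewrite leq_eqVlt => /orP[/eqP->|in']; first by rewrite LX.
  rewrite -LX in XY.
  have /ltL ltin : (i < n <= n)%N by rewrite in' leqnn.
  exact: proper_sub_trans ltin (properW XY).
- by rewrite ltnn.
Qed.

End Chains.

Lemma max_chain_length_inj (T : Type) (S : set (set T)) n p :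
  max_chain_length S n -> max_chain_length S p -> n = p.
Proof. by move=> [Sn ltn] [Sp ltp]; apply/eqP; rewrite eqn_leq ltn // ltp. Qed.

Lemma chain_of_map (T T' : Type) (S : set (set T)) (S' : set (set T'))
    (phi : set T -> set T') n :
  (forall X, S X -> S' (phi X)) ->
  (forall X Y, S X -> S Y -> X `<` Y -> phi X `<` phi Y) ->
  chain_of S n -> chain_of S' n.
Proof.
move=> phiS phiP [L [SL ltL]]; exists (phi \o L); split=> [i|i j ij].
  exact: phiS.
by apply: phiP => //; exact: ltL.
Qed.

Section Length.
Variables (R : pzRingType) (M : lmodType R).
Implicit Types (A B C X Y : set M).

(** By the correspondence theorem these are the submodules of [B / A]; lengths of subquotients are
    thus handled without forming quotient modules. *)
Definition interval A B : set (set M) :=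
  [set X | [/\ is_submod X, A `<=` X & X `<=` B]].

Definition has_length A B n := max_chain_length (interval A B) n.

Lemma has_length_exists A B n : is_submod A -> A `<=` B ->
  (forall k X, chain_to (interval A B) k X -> (k <= n)%N) ->
  exists p, has_length A B p.
Proof.
move=> sA AB bn.
have P0 : exists k, `[< exists X, chain_to (interval A B) k X >].
  by exists 0%N; apply/asboolP; exists A; apply: chain_to0; split.
have Pn k : `[< exists X, chain_to (interval A B) k X >] -> (k <= n)%N.
  by move/asboolP => [X /bn].
case: (ex_maxnP P0 Pn) => p /asboolP pX maxp; exists p; split.
  exact/chain_ofP.
by move=> k /chain_ofP kX; apply: maxp; apply/asboolP.
Qed.

Lemma has_length_le A B n k X :
  has_length A B n -> chain_to (interval A B) k X -> (k <= n)%N.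
Proof. by move=> [_ len] chX; apply: len; apply/chain_ofP; exists X. Qed.

Lemma has_length_refl A : is_submod A -> has_length A A 0.
Proof.
move=> sA; split; first by apply/chain_ofP; exists A; apply: chain_to0; split.
move=> k /chain_ofP[X []//] n {}X Y /chain_to_last[_ AX XA] [_ AY YA] [_ nYX].
by case: nYX => y /YA/AX.
Qed.

Lemma has_length0_sub A B : is_submod A -> is_submod B -> A `<=` B ->
  has_length A B 0 -> B `<=` A.
Proof.
move=> sA sB AB lenAB; apply: contrapT => nBA.
suff /(has_length_le lenAB) : chain_to (interval A B) 1 B by [].
by apply: (@chain_toS _ _ _ A); [apply: chain_to0| |]; split.
Qed.

Lemma has_length_eq0 A B n : is_submod A -> B `<=` A -> has_length A B n -> n = 0%N.
Proof.
move=> sA BA [[L [iL ltL]] _]; case: n L iL ltL => // n L iL ltL.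
have [_ _ L1B] := iL (inord 1); have [_ AL0 _] := iL ord0.
have [|_ []] := ltL ord0 (inord 1); first by rewrite inordK.
by move=> y /L1B/BA/AL0.
Qed.

Definition sum_set A B : set M := [set z | exists u v, [/\ A u, B v & z = u + v]].

Lemma sum_set_submod A B : is_submod A -> is_submod B -> is_submod (sum_set A B).
Proof.
move=> sA sB; split; first by exists 0, 0; rewrite addr0; split=> //; exact: submod0.
move=> c _ _ [u [v [Au Bv ->]]] [u' [v' [Au' Bv' ->]]].
exists (c *: u + u'), (c *: v + v'); split; [exact: sA.2|exact: sB.2|].
by rewrite scalerDr addrACA.
Qed.

Lemma sum_set_subl A B : is_submod B -> A `<=` sum_set A B.
Proof. by move=> sB u Au; exists u, 0; rewrite addr0; split=> //; exact: submod0. Qed.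

Lemma sum_set_subr A B : is_submod A -> B `<=` sum_set A B.
Proof. by move=> sA u Bu; exists 0, u; rewrite add0r; split=> //; exact: submod0. Qed.

Lemma setI_submod A B : is_submod A -> is_submod B -> is_submod (A `&` B).
Proof.
move=> sA sB; split; first by split; exact: submod0.
by move=> c u v [Au Bu] [Av Bv]; split; [exact: sA.2|exact: sB.2].
Qed.

Section Additivity.
Variables (A B C : set M).
Hypotheses (sA : is_submod A) (sB : is_submod B) (AB : A `<=` B) (BC : B `<=` C).

(* The modular law: a strict inclusion stays strict after intersecting with [B]
   or after adding [B]. *)
Lemma chain_split n X : is_submod C -> chain_to (interval A C) n X ->
  exists p q, [/\ n = (p + q)%N, chain_to (interval A B) p (X `&` B) &
                  chain_to (interval B C) q (sum_set X B)].
Proof.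
move=> sC.
have iI X' : interval A C X' -> interval A B (X' `&` B).
  move=> [sX AX _]; split=> [|y Ay|y []//]; first exact: setI_submod.
  by split; [exact: AX|exact: AB].
have iS X' : interval A C X' -> interval B C (sum_set X' B).
  move=> [sX _ XC]; split=> [||_ [u [v [Xu Bv ->]]]]; first exact: sum_set_submod.
    exact: sum_set_subr.
  by apply: (submodD sC); [exact: XC|exact: BC].
elim=> [{}X iX|{}n {}X Y chX [p [q [-> chI chS]]] iY [XY nYX]].
  by exists 0%N, 0%N; split=> //; apply: chain_to0; [exact: iI|exact: iS].
have [sX _ _] := chain_to_last chX; have [sY _ _] := iY.
have XYI : X `&` B `<=` Y `&` B by move=> y [/XY].
have XYS : sum_set X B `<=` sum_set Y B.
  by move=> _ [u [v [/XY Yu Bv ->]]]; exists u, v.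
have [YXI|nYXI] := pselect (Y `&` B `<=` X `&` B); last first.
  exists p.+1, q; split; [by rewrite addSn| |exact: (chain_to_le chS (iS _ iY))].
  exact: (chain_toS chI (iI _ iY)).
exists p, q.+1; split; [by rewrite addnS|exact: (chain_to_le chI (iI _ iY))|].
apply: chain_toS chS (iS _ iY) _; split=> // YXS; apply: nYX => y Yy.
have [u [v [Xu Bv yE]]] := YXS y (sum_set_subl sB Yy).
have [Xv _] : (X `&` B) v.
  apply: YXI; split=> //; rewrite -[v](addKr u) -yE addrC.
  by apply: (submodB sY) => //; exact: XY.
by rewrite yE; exact: (submodD sX).
Qed.

(** The top of the lower chain lies in the bottom of the upper one. Exchanging the former for the
    latter glues the chains without losing a step. *)
Lemma chain_cat p q X Y : chain_to (interval A B) p X ->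
  chain_to (interval B C) q Y -> chain_to (interval A C) (p + q) Y.
Proof.
move=> chX; have [_ _ XB] := chain_to_last chX.
have up Z : interval B C Z -> interval A C Z.
  by move=> [sZ BZ ZC]; split=> // y /AB/BZ.
have chX' : chain_to (interval A C) p X.
  elim: {XB} chX => [{}X [sX AX XB]|k {}X Z _ IH [sZ AZ ZB] XZ].
    by apply: chain_to0; split=> // y /XB/BC.
  by apply: chain_toS IH _ XZ; split=> // y /ZB/BC.
elim=> [{}Y iY|{}q {}Y Z _ IH iZ YZ].
  rewrite addn0; apply: chain_to_le chX' (up _ iY) _.
  by have [_ BY _] := iY; move=> y /XB/BY.
by rewrite addnS; apply: chain_toS IH (up _ iZ) YZ.
Qed.

Lemma has_length_add p q : is_submod C ->
  has_length A B p -> has_length B C q -> has_length A C (p + q).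
Proof.
move=> sC lenAB lenBC; split.
  case: lenAB lenBC => /chain_ofP[X chX] _ [/chain_ofP[Y chY] _].
  by apply/chain_ofP; exists Y; exact: chain_cat chX chY.
move=> k /chain_ofP[X /(chain_split sC)[p' [q' [-> chp chq]]]].
by rewrite leq_add // (has_length_le _ chp, has_length_le _ chq).
Qed.

Lemma has_length_split n : is_submod C -> has_length A C n ->
  exists p q, [/\ n = (p + q)%N, has_length A B p & has_length B C q].
Proof.
move=> sC lenAC.
have [p lenAB] : exists p, has_length A B p.
  apply: (has_length_exists (n := n)) => // k X chX.
  suff : chain_to (interval A C) (k + 0) B.
    by move/(has_length_le lenAC); rewrite addn0.
  by apply: chain_cat chX _; apply: chain_to0; split.
have [q lenBC] : exists q, has_length B C q.
  apply: (has_length_exists (n := n)) => // k X chX.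
  apply: (has_length_le lenAC); rewrite -[k]add0n; apply: (chain_cat (X := A) _ chX).
  by apply: chain_to0; split.
exists p, q; split=> //; apply: max_chain_length_inj lenAC _.
exact: has_length_add.
Qed.

End Additivity.
End Length.

Section LengthTransfer.
Variables (R : pzRingType) (M M' : lmodType R) (f : M -> M').
Variables (A B : set M) (A' B' : set M').
Hypothesis flin : forall c u v, f (c *: u + v) = c *: f u + f v.
Hypotheses (sA : is_submod A) (sB : is_submod B) (AB : A `<=` B).
Hypotheses (sA' : is_submod A') (sB' : is_submod B') (AB' : A' `<=` B').
Hypothesis fB : forall u, B u -> B' (f u).
Hypothesis fA : forall u, B u -> A' (f u) <-> A u.
Hypothesis fsurj : forall v, B' v -> exists2 u, B u & A' (v - f u).

(** The hypotheses say that [f] induces an isomorphism from [B / A] onto [B' / A']. Preimages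
    ([psi]) and images modulo [A'] ([phi]) preserve strict inclusions, so chains travel both
    ways. *)
Lemma has_length_transfer n : has_length A B n <-> has_length A' B' n.
Proof.
have f0 : f 0 = 0 by have := flin (-1) 0 0; rewrite scaler0 addr0 scaleN1r addNr.
have fB' u v : f (u - v) = f u - f v by rewrite addrC -scaleN1r flin scaleN1r addrC.
pose psi (X' : set M') := B `&` [set u | X' (f u)].
pose phi (X : set M) := [set v | exists2 u, X u & A' (v - f u)].
have psiI X' : interval A' B' X' -> interval A B (psi X').
  move=> [sX AX XB]; split.
  - apply: setI_submod => //; split; first by rewrite /= f0; exact: submod0.
    by move=> c u v /= Xu Xv; rewrite flin; exact: sX.2.
  - by move=> u Au; split; [exact: AB|apply: AX; apply/fA => //; exact: AB].
  - by move=> u [].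
have phiI X : interval A B X -> interval A' B' (phi X).
  move=> [sX AX XB]; split.
  - split; first by exists 0; [exact: submod0|rewrite f0 subr0; exact: submod0].
    move=> c v w [u Xu Av] [u' Xu' Aw]; exists (c *: u + u'); first exact: sX.2.
    have -> : c *: v + w - f (c *: u + u') = c *: (v - f u) + (w - f u').
      by rewrite flin scalerBr opprD addrACA.
    exact: sA'.2.
  - by move=> v Av; exists 0; [exact: submod0|rewrite f0 subr0].
  - move=> v [u /XB Bu Av]; rewrite -[v](subrK (f u)).
    by apply: (submodD sB'); [exact: AB'|exact: fB].
have psiP X Y : interval A' B' X -> interval A' B' Y -> X `<` Y -> psi X `<` psi Y.
  move=> [sX AX XB] [sY AY YB] [XY nYX]; split=> [u [Bu /XY]//|YX].
  apply: nYX => v Yv; have [u Bu Av] := fsurj (YB _ Yv).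
  rewrite -[v](subrK (f u)); apply: (submodD sX); first exact: AX.
  suff [] : psi X u by [].
  apply: YX; split=> //=; rewrite -[f u](subKr v).
  by apply: (submodB sY) => //; exact: AY.
have phiP X Y : interval A B X -> interval A B Y -> X `<` Y -> phi X `<` phi Y.
  move=> [sX AX XB] [sY AY YB] [XY nYX]; split=> [v [u /XY Yu Av]|YX].
    by exists u.
  apply: nYX => u Yu; have [|w Xw Auw] := YX (f u).
    by exists u => //; rewrite subrr; exact: submod0.
  rewrite -[u](subrK w); apply: (submodD sX) => //; apply: AX.
  by apply/fA; rewrite ?fB' //; apply: (submodB sB); [exact: YB|exact: XB].
split=> -[ch len]; split=> [|k chk].
- exact: chain_of_map phiI phiP ch.
- by apply: len; exact: chain_of_map psiI psiP chk.
- exact: chain_of_map psiI psiP ch.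
- by apply: len; exact: chain_of_map phiI phiP chk.
Qed.

End LengthTransfer.

(** The factors are enlarged one at a time: [C s] has [B j] at the indices in [s] and [A j]
    elsewhere, and projection to coordinate [i] identifies the step from [C s] to [C (i :: s)] with
    [B i / A i]. *)
Lemma has_length_prod (R : pzRingType) (M : lmodType R) (J : finType)
    (A B : J -> set M) (h : J -> nat) :
  (forall j, is_submod (A j)) -> (forall j, is_submod (B j)) ->
  (forall j, A j `<=` B j) -> (forall j, has_length (A j) (B j) (h j)) ->
  @has_length R (J -> M) [set u | forall j, A j (u j)]
    [set u | forall j, B j (u j)] (\sum_j h j).
Proof.
move=> sA sB AB lenAB.
pose C (s : seq J) : set (J -> M) :=
  [set u | forall j, (if j \in s then B j else A j) (u j)].
have sC s : is_submod (C s).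
  split=> [j|c u v Cu Cv j]; first by case: ifP => _; exact: submod0.
  by move: (Cu j) (Cv j); case: ifP => _; [exact: (sB j).2|exact: (sA j).2].
have CC i s : C s `<=` C (i :: s).
  move=> u Cu j; move: (Cu j); rewrite inE.
  by case: (j \in s); rewrite ?orbT // orbF; case: eqP => // _; exact: AB.
have C0C s : C [::] `<=` C s.
  by elim: s => [//|i s IH] u /IH/CC.
suff main s : uniq s -> has_length (C [::]) (C s) (\sum_(j <- s) h j).
  have := main _ (enum_uniq J); rewrite big_enum /=.
  suff -> : C (enum J) = [set u | forall j, B j (u j)].
    by congr (has_length _ _ _); apply/seteqP; split=> u Cu j; have := Cu j.
  by apply/seteqP; split=> u Cu j; have := Cu j; rewrite mem_enum.
elim: s => [_|i s IH /= /andP[is_ us]].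
  by rewrite big_nil; exact: has_length_refl.
rewrite big_cons addnC.
apply: (has_length_add (sC s) (C0C s) (CC i s) (sC _) (IH us)).
apply/(@has_length_transfer R (J -> M) M (fun u => u i) _ _ (A i) (B i)) => //.
  - by move=> u /(_ i); rewrite inE eqxx.
  - move=> u Cu; split=> [Au j|/(_ i)]; last by rewrite (negPf is_).
    move: (Cu j); rewrite inE; case: eqP => [->|//]; by rewrite (negPf is_).
  - move=> v Bv; exists (fun j => if j == i then v else 0); last first.
      by rewrite eqxx subrr; exact: submod0.
    move=> j; rewrite inE; case: eqP => [->//|_] /=.
    by case: ifP => _; exact: submod0.
Qed.

Lemma quot_mod_projD (R : pzRingType) (M : lmodType R) (N : submodule M) :
  {morph quot_mod_proj N : u v / u + v}.
Proof. exact: Quotient.pi_add. Qed.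

Lemma quot_mod_proj_eq0 (R : pzRingType) (M : lmodType R) (N : submodule M) u :
  quot_mod_proj N u = 0 <-> submodule_set N u.
Proof.
have p0 : quot_mod_proj N 0 = 0.
  by apply: (addrI (quot_mod_proj N 0)); rewrite -quot_mod_projD !addr0.
have : (quot_mod_proj N u == quot_mod_proj N 0) = (u - 0 \in submodule_pred N).
  by rewrite Quotient.idealrBE.
rewrite p0 subr0 => uE; split=> [/eqP|Nu]; first by rewrite uE => /asboolP.
by apply/eqP; rewrite uE; exact/asboolP.
Qed.

(** The bridge from [has_length] to [mod_length]: the length is carried along the inclusion of [N]
    in [M] and then along the projection onto [N / N']. *)
Lemma mod_length_quot (R : pzRingType) (M : lmodType R) (N N' : submodule M) n :
  N' `<=` N -> has_length N' N n ->
  mod_length (quot_mod (restrict_submod N N')) = n.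
Proof.
move=> N'N lenN.
have sN := submoduleP N; have sN' := submoduleP N'.
pose Q := quot_mod (restrict_submod N N').
have s0 : @is_submod R Q [set 0].
  by split=> [//|c _ _ -> ->] /=; rewrite scaler0 addr0.
have sT (V : lmodType R) : is_submod [set: V] by [].
have val_len : @has_length R (sub_mod N) (restrict_submod N N') setT n.
  apply/(@has_length_transfer _ _ _ (val : sub_mod N -> M) _ _ N' N) => //.
  - by move=> u _; exact: asboolW (valP u).
  - move=> v Nv; have Nv' : submodule_pred N v by apply/asboolP.
    by exists (Sub v Nv' : sub_mod N) => //; rewrite SubK subrr; exact: submod0.
have Q_len : @has_length R Q [set 0] setT n.
  apply/(@has_length_transfer _ _ Q (quot_mod_proj (restrict_submod N N'))
    (restrict_submod N N') setT) => //.
  - move=> c u v; rewrite [c *: quot_mod_proj _ u]quot_scaleE.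
    exact: quot_mod_projD.
  - by move=> u _; exact: quot_mod_proj_eq0.
  - move=> v _; exists (repr v) => //=; rewrite /quot_mod_proj reprK subrr //.
have maxn : max_chain_length (@is_submod R Q) n.
  suff -> : @is_submod R Q = interval [set 0] setT by [].
  apply/funext => X; apply/propext; split=> [sX|[]//]; split=> // _ ->.
  exact: submod0.
rewrite /mod_length; case: xgetP => [k _ maxk|/(_ n)//].
exact: max_chain_length_inj maxk maxn.
Qed.

(** * Noetherian induction and finite length *)

(** Without a maximal element, choice yields a strictly increasing sequence of ideals. The finitely
    many generators of its union already lie in one term, where the sequence would have to stop. *)
Lemma noetherian_max (A : comPzRingType) (P : set A -> Prop) :
  noetherian A -> (exists b, is_ideal b /\ P b) ->
  exists b, [/\ is_ideal b, P b &
    forall c, is_ideal c -> P c -> b `<=` c -> c `<=` b].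
Proof.
move=> noeth [b0 [ib0 Pb0]]; apply: contrapT => nomax.
have /choice[next nextP] : forall b, exists c, is_ideal b /\ P b ->
    [/\ is_ideal c, P c & b `<` c].
  move=> b; have [[ib Pb]|] := pselect (is_ideal b /\ P b); last by exists b.
  apply: contrapT => nc; apply: nomax; exists b; split=> // c ic Pc bc.
  by apply: contrapT => ncb; apply: nc; exists c.
pose B k := iter k next b0.
have BP k : is_ideal (B k) /\ P (B k).
  by elim: k => [//|k /nextP[ic Pc _]].
have BS k : B k `<` B k.+1 by have [] := nextP _ (BP k).
have Ble k l : (k <= l)%N -> B k `<=` B l.
  move/subnKC <-; elim: (l - k)%N => [|i IH]; rewrite ?addn0 // addnS => y.
  by move/IH/(properW (BS _)).
pose U := [set y | exists k, B k y].
have iU : is_ideal U.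
  split; first by exists 0%N; exact: (submod0 (BP 0%N).1).
  move=> c y z [k By] [l Bz]; exists (maxn k l); apply: (BP _).1.2.
    exact: Ble (leq_maxl _ _) _ By.
  exact: Ble (leq_maxr _ _) _ Bz.
have [s Us] := noeth _ iU.
have [k sk] : exists k, forall y, y \in s -> B k y.
  have : forall y, y \in s -> U y by move=> y ys; rewrite Us; exact: ideal_gen_sub.
  elim: s {Us} => [_|y s IH sU]; first by exists 0%N.
  have [k sk] : exists k, forall y, y \in s -> B k y.
    by apply: IH => z zs; apply: sU; rewrite inE zs orbT.
  have [l Bl] : U y by apply: sU; rewrite inE eqxx.
  exists (maxn k l) => z; rewrite inE => /orP[/eqP->|/sk].
    exact: Ble (leq_maxr _ _) _ Bl.
  exact: Ble (leq_maxl _ _) _.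
have [_] := BS k; apply=> y By.
have : U y by exists k.+1.
by rewrite Us; apply: ideal_gen_min => //; exact: (BP k).1.
Qed.

Lemma has_length_maximal (A : comPzRingType) (m : set A) :
  is_maximal m -> exists n, @has_length A A^o m setT n.
Proof.
move=> [im _ maxm]; apply: (has_length_exists (n := 1%N)) => // k X.
case=> // k' {}X Y [] // k'' Z {}X chX iX ZX iY XY.
have [sX mX _] := iX; case: (maxm X sX mX) => Xm.
  have [_ mZ _] := chain_to_last chX; case: ZX => _.
  by rewrite Xm => /(_ mZ).
by case: XY => _ []; rewrite Xm.
Qed.

(* Noetherian induction: if [z \notin Q] has a power in [Q], then [A / Q] is an
   extension of [A / (Q + z A)] by [z A / (Q :&: z A)], that is by [A / (Q : z)],
   and both [Q + z A] and [Q : z] are larger than [Q]. *)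
Lemma has_length_primary (A : comPzRingType) (m Q : set A) :
  noetherian A -> is_maximal m -> is_ideal Q -> m `<=` radical Q ->
  exists n, @has_length A A^o Q setT n.
Proof.
move=> noeth maxm iQ mQ; apply: contrapT => nQ.
have bad : exists b, is_ideal b /\ (m `<=` radical b /\
    ~ exists n, @has_length A A^o b setT n) by exists Q.
have [{mQ nQ bad}{}Q [{}iQ [mQ nQ] maxQ]] := noetherian_max noeth bad.
have larger c : is_ideal c -> Q `<` c -> exists n, @has_length A A^o c setT n.
  move=> ic [Qc ncQ]; apply: contrapT => nc; apply: ncQ.
  apply: maxQ => //; split=> // z /mQ[n Qzn]; exists n; exact: Qc.
apply: nQ; have [Q1|nQ1] := pselect (Q 1).
  suff -> : Q = setT by exists 0%N; exact: has_length_refl.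
  by apply/seteqP; split=> // y _; rewrite -[y]mulr1; exact: (idealM iQ).
have [mQ'|/existsNP[z /not_implyP[mz nQz]]] := pselect (m `<=` Q).
  have [_ _ /(_ Q iQ mQ')[->|QT]] := maxm; first exact: has_length_maximal.
  by case: nQ1; rewrite QT.
(* For such a [k], the power [z ^+ k] lies in [Q : z] but not in [Q], so [Q : z] is strictly larger
   than [Q]. *)
have [k [Qk nQk]] : exists k, Q (z ^+ k.+1) /\ ~ Q (z ^+ k).
  have [n] := mQ z mz; elim: n => [/nQ1//|n IH Qn].
  by have [/IH//|nQn] := pselect (Q (z ^+ n)); exists n.
have k0 : (0 < k)%N by case: k Qk {nQk} => //; rewrite expr1.
pose Q1 : set A := [set y | Q (z * y)].
have iQ1 : is_ideal Q1.
  split; first by rewrite /Q1 /= mulr0; exact: (submod0 iQ).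
  by move=> c u v; rewrite /Q1 /= mulrDr => Qu Qv; rewrite [z * _]mulrCA; exact: iQ.2.
pose Q2 : set A := [set y | exists u, Q (y - z * u)].
have iQ2 : is_ideal Q2.
  split; first by exists 0; rewrite mulr0 subr0; exact: (submod0 iQ).
  move=> c u v [p Qp] [q Qq]; exists (c * p + q).
  have -> : c *: (u : A^o) + v - z * (c * p + q) =
            c *: (u - z * p : A^o) + (v - z * q) by rewrite /GRing.scale /=; ring.
  exact: iQ.2.
have QQ2 : Q `<=` Q2 by move=> y Qy; exists 0; rewrite mulr0 subr0.
have [p lenQ1] : exists n, @has_length A A^o Q1 setT n.
  apply: larger => //; split=> [y Qy|Q1Q]; first exact: (idealM iQ).
  by apply: nQk; apply: Q1Q; rewrite /Q1 /= -exprS.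
have [q lenQ2] : exists n, @has_length A A^o Q2 setT n.
  apply: larger => //; split=> // Q2Q; apply: nQz; apply: Q2Q; exists 1.
  by rewrite mulr1 subrr; exact: (submod0 iQ).
exists (p + q)%N; apply: (has_length_add iQ2 _ _ _ _ lenQ2) => //.
(* Multiplication by [z] induces an isomorphism from [A / (Q : z)] onto [(Q + z A) / Q]. *)
apply/(@has_length_transfer A A^o A^o (fun y => z * y) Q1 setT) => //.
- by move=> c u v; rewrite mulrDr [z * _]mulrCA.
- by move=> u _; exists u; rewrite subrr; exact: (submod0 iQ).
- by move=> v [u Qu]; exists u.
Qed.

(** * Koszul complexes *)

(** The terms at [(i, j)] and [(j, i)] cancel. The diagonal needs its own hypothesis because [V] may
    have 2-torsion. *)
Lemma sum_antisym (V : zmodType) (d : nat) (g : 'I_d -> 'I_d -> V) :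
  (forall i, g i i = 0) -> (forall i j, g i j = - g j i) ->
  \sum_(i < d) \sum_(j < d) g i j = 0.
Proof.
move=> g0 gN.
have -> : \sum_(i < d) \sum_(j < d) g i j =
    \sum_(i < d) \sum_(j < d | (i < j)%N) g i j +
    \sum_(i < d) \sum_(j < d | (j < i)%N) g i j.
  rewrite -big_split /=; apply: eq_bigr => i _.
  rewrite (bigID (fun j : 'I_d => (i < j)%N)) /=; congr (_ + _).
  rewrite (bigD1 i) /= ?ltnn // g0 add0r; apply: eq_bigl => j.
  by rewrite -leqNgt [in RHS]ltn_neqAle andbC.
rewrite [X in _ + X](exchange_big_dep xpredT) //= -big_split big1 //= => i _.
by rewrite -big_split big1 //= => j _; rewrite gN addNr.
Qed.

Section Koszul.
Variables (A : comPzRingType) (d : nat).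
Implicit Types (x u : 'I_d -> A) (a w : {set 'I_d} -> A) (T S : {set 'I_d}).

Definition koszul_sign (j : 'I_d) T : A :=
  (-1) ^+ #|finset (fun k : 'I_d => (k \in T) && (k < j)%N)|.

(** A Koszul chain is the family of its coefficients on the exterior basis indexed by subsets [T],
    all homological degrees [#|T|] at once. The coefficient of the differential at [T] collects
    those at the sets with one more element. *)
Definition koszul_diff x a T : A :=
  \sum_(j | j \notin T) koszul_sign j T * x j * a (j |: T)%SET.

(** Left exterior multiplication by the vector with coordinates [u j]. *)
Definition koszul_wedge u a T : A :=
  \sum_(j in T) koszul_sign j T * u j * a (T :\ j)%SET.

Lemma koszul_signU1 j k T : j \notin T ->
  koszul_sign k (j |: T)%SET = (-1) ^+ (j < k)%N * koszul_sign k T.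
Proof.
move=> jT; rewrite /koszul_sign -exprD; congr (_ ^+ _).
have [jk|jk] := boolP (j < k)%N.
  have -> : finset (fun i : 'I_d => (i \in (j |: T)%SET) && (i < k)%N) =
            (j |: finset (fun i : 'I_d => (i \in T) && (i < k)%N))%SET.
    by apply/setP => i; rewrite !inE; case: eqP => // ->; rewrite jk.
  by rewrite cardsU1 inE (negPf jT).
rewrite add0n; apply: eq_card => i; rewrite !inE.
by case: eqP => // ->; rewrite (negPf jk) (negPf jT).
Qed.

Lemma koszul_signD1 j k T : j \in T ->
  koszul_sign k T = (-1) ^+ (j < k)%N * koszul_sign k (T :\ j)%SET.
Proof. by move=> jT; rewrite -{1}(finset.setD1K jT) koszul_signU1 // !inE eqxx. Qed.

Lemma koszul_sign_sqr j T : koszul_sign j T * koszul_sign j T = 1.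
Proof. by rewrite -expr2 sqrr_sign. Qed.

Lemma koszul_sign0 j : koszul_sign j finset.set0 = 1.
Proof. by rewrite /koszul_sign (eq_card0 (A := _)) // => k; rewrite !inE. Qed.

Lemma sign_lt_gt (j k : 'I_d) : j != k ->
  (-1) ^+ (j < k)%N = - (-1) ^+ (k < j)%N :> A.
Proof.
rewrite neq_ltn => /orP[] jk; rewrite jk ltnNge (ltnW jk) /=.
  by rewrite expr0 expr1.
by rewrite expr0 expr1 opprK.
Qed.

(** Removing two indices in either order gives opposite signs. *)
Lemma koszul_diff_diff x a T : koszul_diff x (koszul_diff x a) T = 0.
Proof.
pose g i j : A := if [&& i != j, i \notin T & j \notin T] then
  koszul_sign i T * x i * (koszul_sign j (i |: T)%SET * x j *
    a (j |: (i |: T))%SET) else 0.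
have -> : koszul_diff x (koszul_diff x a) T = \sum_i \sum_j g i j.
  rewrite /koszul_diff big_mkcond; apply: eq_bigr => i _.
  case: ifP => iT; last first.
    by rewrite big1 // => j _; rewrite /g iT andbF.
  rewrite mulr_sumr big_mkcond; apply: eq_bigr => j _.
  by rewrite /g !inE negb_or iT eq_sym.
apply: sum_antisym => [i|i j]; first by rewrite /g eqxx.
rewrite /g [j == i]eq_sym; have [//|ij] := eqVneq i j; first by rewrite oppr0.
rewrite /= andbC; case: ifP => [/andP[jT iT]|_]; last by rewrite oppr0.
rewrite !koszul_signU1 // (sign_lt_gt ij) finset.setUCA; ring.
Qed.

(** Wedging with [u] is a homotopy from zero to multiplication by [\sum_j x j * u j], so the ideal
    generated by the [x j] kills Koszul homology. The terms with [j = k] give the right-hand side;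
    the others cancel in pairs. *)
Lemma koszul_homotopy x u a T :
  koszul_diff x (koszul_wedge u a) T + koszul_wedge u (koszul_diff x a) T =
  (\sum_j x j * u j) * a T.
Proof.
have wE : koszul_diff x (koszul_wedge u a) T =
    \sum_(j | j \notin T) x j * u j * a T +
    \sum_(j | j \notin T) \sum_(k in T) koszul_sign j T * x j *
      (koszul_sign k (j |: T)%SET * u k * a ((j |: T) :\ k)%SET).
  rewrite -big_split; apply: eq_bigr => j jT /=.
  rewrite /koszul_wedge (bigD1 j) ?inE ?eqxx //= mulrDr; congr (_ + _).
    rewrite koszul_signU1 // ltnn expr0 mul1r finset.setU1K //.
    by rewrite -[RHS]mul1r -(koszul_sign_sqr j T); ring.
  rewrite mulr_sumr; apply: eq_bigl => k; rewrite !inE.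
  by case: eqP => [->|]; rewrite ?(negPf jT) /= ?andbT ?andbF.
have dE : koszul_wedge u (koszul_diff x a) T =
    \sum_(k in T) x k * u k * a T +
    \sum_(k in T) \sum_(j | j \notin T) koszul_sign k T * u k *
      (koszul_sign j (T :\ k)%SET * x j * a (j |: (T :\ k))%SET).
  rewrite -big_split; apply: eq_bigr => k kT /=.
  rewrite /koszul_diff (bigD1 k) ?inE ?eqxx //= mulrDr; congr (_ + _).
    rewrite (koszul_signD1 k kT) ltnn expr0 mul1r finset.setD1K //.
    by rewrite -[RHS]mul1r -(koszul_sign_sqr k (T :\ k)%SET); ring.
  rewrite mulr_sumr; apply: eq_bigl => j; rewrite !inE.
  by case: eqP => [->|]; rewrite ?kT /= ?andbT ?andbF.
rewrite wE dE addrACA [X in _ + (_ + X)]exchange_big -big_split /=.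
rewrite [X in _ + X]big1 ?addr0; last first.
  move=> j jT; rewrite -big_split big1 //= => k kT.
  have jk : j != k by apply: contraNneq jT => ->.
  have -> : ((j |: T) :\ k = j |: (T :\ k))%SET.
    by apply/setP => i; rewrite !inE; case: eqP => // ->; rewrite eq_sym (negPf jk).
  rewrite koszul_signU1 // (koszul_signD1 j kT) (sign_lt_gt jk).
  have := sqrr_sign A (k < j)%N; set e := (-1) ^+ _ => e2.
  by rewrite -[X in _ + X]mul1r -e2; ring.
by rewrite mulr_suml [RHS](bigID (mem T)) addrC.
Qed.

Lemma koszul_diffB x a w T :
  koszul_diff x (fun S => a S - w S) T = koszul_diff x a T - koszul_diff x w T.
Proof. by rewrite /koszul_diff -sumrB; apply: eq_bigr => j _; rewrite mulrBr. Qed.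

Lemma koszul_diffD x a w T :
  koszul_diff x (fun S => a S + w S) T = koszul_diff x a T + koszul_diff x w T.
Proof. by rewrite /koszul_diff -big_split; apply: eq_bigr => j _; rewrite mulrDr. Qed.

Lemma koszul_diffZ x c w T :
  koszul_diff x (fun S => c * w S) T = c * koszul_diff x w T.
Proof. by rewrite /koszul_diff mulr_sumr; apply: eq_bigr => j _; rewrite mulrCA. Qed.

Lemma eq_koszul_diff x a w T :
  (forall S, #|S| = #|T|.+1 -> a S = w S) -> koszul_diff x a T = koszul_diff x w T.
Proof. by move=> aw; apply: eq_bigr => j jT; rewrite aw // cardsU1 jT. Qed.

Lemma koszul_diff_eq0 x a T :
  (forall S, #|S| = #|T|.+1 -> a S = 0) -> koszul_diff x a T = 0.
Proof.
by move=> a0; rewrite /koszul_diff big1 // => j jT; rewrite a0 ?mulr0 // cardsU1 jT.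
Qed.

End Koszul.

(** * Depth sensitivity of Koszul homology *)

Section DepthSensitivity.
Variables (A : comPzRingType) (d : nat) (x : 'I_d -> A).
Implicit Types (a w : {set 'I_d} -> A) (T S : {set 'I_d}) (b : set A).

Lemma koszul_diff_ideal b a T : is_ideal b ->
  (forall S, #|S| = #|T|.+1 -> b (a S)) -> b (koszul_diff x a T).
Proof.
move=> ib ba; apply: (submod_sum ib) => j jT.
by apply: (idealM ib); apply: ba; rewrite cardsU1 jT.
Qed.

Lemma koszul_wedge_ideal u b a T : is_ideal b ->
  (forall S, #|S|.+1 = #|T| -> b (a S)) -> b (koszul_wedge u a T).
Proof.
move=> ib ba; apply: (submod_sum ib) => j jT.
by apply: (idealM ib); apply: ba; rewrite [in RHS](cardsD1 j) jT.
Qed.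

(* Vanishing of the Koszul homology of [A / b] in all degrees [>= i]. *)
Definition koszul_exact b (i : nat) :=
  forall a, (forall T, (i <= #|T|.+1)%N -> b (koszul_diff x a T)) ->
  exists w, forall S, (i <= #|S|)%N -> b (a S - koszul_diff x w S).

Definition in_radical_of (z : A) := exists N u, z ^+ N = \sum_j x j * u j.

(** Here [b'] is [b + z A] and [z] is regular modulo [b]. In the long exact sequence, the vanishing
    of the homology of [A / b'] above degree [i] makes [z] injective on that of [A / b] from degree
    [i] on; there [z] is also nilpotent, so this homology is zero. *)
Lemma koszul_exact_quotient b b' z i : is_ideal b ->
  (forall y, b' y <-> exists q, b (y - z * q)) ->
  (forall y, b (z * y) -> b y) -> in_radical_of z ->
  koszul_exact b' i.+1 -> koszul_exact b i.
Proof.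
move=> ib b'E zreg [N [u zN]] ex' a ba.
pose P k := exists w, forall S, (i <= #|S|)%N ->
  b (z ^+ k * a S - koszul_diff x w S).
suff : P 0%N by case=> w aw; exists w => S /aw; rewrite mul1r.
have : P N.
  (* By the homotopy, [z ^+ N] kills the homology. *)
  exists (koszul_wedge u a) => S iS; rewrite zN -koszul_homotopy addrC addKr.
  by apply: koszul_wedge_ideal => // T TS; apply: ba; rewrite TS.
elim: N {zN} => [//|k IH] [w aw]; apply: IH; pose c S := z ^+ k * a S.
(* The boundary of [w] is a multiple of [z] modulo [b], so [w] is a cycle modulo [b'] and equals a
   boundary plus [z * q] modulo [b]. This [q] bounds [z ^+ k * a] once [z] is cancelled. *)
have [v wv] : exists v, forall S, (i < #|S|)%N -> b' (w S - koszul_diff x v S).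
  apply: ex' => T iT; apply/b'E; exists (c T).
  rewrite -opprB; apply: (submodN ib); rewrite mulrA -exprS; exact: aw.
have /choice[q wq] : forall S, exists q, (i < #|S|)%N ->
    b (w S - koszul_diff x v S - z * q).
  move=> S; have [iS|_] := boolP (i < #|S|)%N; last by exists 0.
  by have /b'E[q bq] := wv S iS; exists q.
exists q => S iS; apply: zreg.
have -> : z * (z ^+ k * a S - koszul_diff x q S) =
    z ^+ k.+1 * a S - koszul_diff x w S +
    koszul_diff x (fun S => w S - koszul_diff x v S - z * q S) S.
  rewrite (koszul_diffB x (fun S => w S - koszul_diff x v S) (fun S => z * q S)).
  by rewrite koszul_diffB koszul_diff_diff koszul_diffZ exprS; ring.
apply: (submodD ib); first exact: aw.
by apply: koszul_diff_ideal => // U US; apply: wq; rewrite US.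
Qed.

(** Descends along the prefixes of the regular sequence [s]: each element taken back from the
    quotient lowers by one the degree from which homology vanishes. *)
Theorem koszul_depth_sensitivity s i :
  (forall k, (k < size s)%N -> forall y, ideal_gen [set` take k s] (s`_k * y) ->
     ideal_gen [set` take k s] y) ->
  (forall z, z \in s -> in_radical_of z) ->
  (d < i + size s)%N -> koszul_exact [set 0] i.
Proof.
move=> sreg srad.
suff main n j : (n <= size s)%N -> (d < j + n)%N ->
    koszul_exact (ideal_gen [set` take (size s - n) s]) j.
  by move=> /main-/(_ (leqnn _)); rewrite subnn take0 ideal_gen_nil.
elim: n j => [|n IH] j ns dj.
  (* Modulo all of [s] the claim concerns degrees above [d] only, where no subset [S] exists. *)
  move=> a _; exists (fun=> 0) => S jS.
  have := leq_trans jS (max_card _).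
  by rewrite card_ord leqNgt -[j]addn0 dj.
have ks : (size s - n.+1 < size s)%N by rewrite -subn_gt0 subKn.
have kS : (size s - n = (size s - n.+1).+1)%N by rewrite subnSK.
have szk : s`_(size s - n.+1) \in s by exact: mem_nth.
apply: (koszul_exact_quotient (ideal_gen_ideal _) _ (sreg _ ks) (srad _ szk)
  (IH _ (ltnW ns) _)); last by rewrite addSnnS.
by move=> y; rewrite kS (take_nth 0 ks); exact: ideal_gen_rcons.
Qed.

End DepthSensitivity.

(** * Ring morphisms and the Koszul differential *)

Lemma quot_ring_proj_is_zmod_morphism (A : comPzRingType) (a : ideal A) :
  zmod_morphism (quot_ring_proj a).
Proof.
have projD : {morph quot_ring_proj a : y z / y + z} by exact: Quotient.pi_add.
by move=> y z; apply: (addIr (quot_ring_proj a z)); rewrite -projD !subrK.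
Qed.

HB.instance Definition _ (A : comPzRingType) (a : ideal A) :=
  GRing.isZmodMorphism.Build A (quot_ring a) (quot_ring_proj a)
    (@quot_ring_proj_is_zmod_morphism A a).

HB.instance Definition _ (A : comPzRingType) (a : ideal A) :=
  GRing.isMonoidMorphism.Build A (quot_ring a) (quot_ring_proj a)
    (conj (erefl _) (fun x y => esym (quot_mulE a x y))).

Lemma quot_ring_proj_eq0 (A : comPzRingType) (a : ideal A) (y : A) :
  quot_ring_proj a y = 0 <-> submodule_set a y.
Proof.
have : (quot_ring_proj a y == quot_ring_proj a 0) =
    ((y - 0 : A^o) \in submodule_pred a).
  by rewrite Quotient.idealrBE.
rewrite raddf0 subr0 => yE; split=> [/eqP|ay]; first by rewrite yE => /asboolP.
by apply/eqP; rewrite yE; exact/asboolP.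
Qed.

Lemma rmorph_koszul_diff (A A' : comPzRingType) (f : {rmorphism A -> A'}) d
    (x : 'I_d -> A) a T :
  f (koszul_diff x a T) = koszul_diff (f \o x) (f \o a) T.
Proof.
by rewrite rmorph_sum; apply: eq_bigr => j _; rewrite !rmorphM rmorph_sign.
Qed.

Lemma coef_koszul_diff (A : comNzRingType) d (x : 'I_d -> A)
    (p : {set 'I_d} -> {poly A}) T k :
  (koszul_diff (fun j => x j *: 'X) p T)`_k =
  if k is l.+1 then koszul_diff x (fun S => (p S)`_l) T else 0.
Proof.
rewrite coef_sum; case: k => [|k].
  by rewrite big1 // => j _; rewrite -scalerAr -!scalerAl coefZ mulrAC coefMX mulr0.
apply: eq_bigr => j _; rewrite -scalerAr -!scalerAl coefZ mulrAC coefMX /=.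
rewrite /koszul_sign -[in LHS]signr_odd -[in RHS]signr_odd.
by case: (odd _); rewrite ?expr0 ?expr1 ?mulN1r ?coefN ?mul1r ?mulrN ?mulNr.
Qed.

(** * The associated graded ring *)

Section Rees.
Variables (R : comNzRingType) (I : set R) (F : filtration I).

Local Notation pol p := (val (p : rees F) : {poly R}).

Lemma fil_nonpos (n : int) y : n <= 0 -> F n y.
Proof. by move=> n0; apply: fil_exp; case: n n0 => [[]|]. Qed.

Lemma fil_le (p n : int) y : n <= p -> F p y -> F n y.
Proof. by move=> np; exact: fil_anti. Qed.

(** The default value 0 is taken when some coefficient of [p] is outside the filtration. *)
Definition rees_of (p : {poly R}) : rees F := insubd 0 p.

Lemma val_rees_of (p : {poly R}) : (forall n : nat, F n p`_n) -> pol (rees_of p) = p.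
Proof. by move=> Fp; apply: insubdK; exact/asboolP. Qed.

Lemma rees_coef (p : rees F) (n : nat) : F n (pol p)`_n.
Proof. exact: (asboolW (valP p)). Qed.

Lemma val_rees_mono (n : nat) y : F n y -> pol (rees_of (y *: 'X^n)) = y *: 'X^n.
Proof.
move=> Fy; apply: val_rees_of => k; rewrite coefZ coefXn.
by case: eqP => [->|_]; rewrite ?mulr1 // mulr0; exact: fil0.
Qed.

HB.instance Definition _ :=
  GRing.RMorphism.copy (gr_proj F) (gr_proj F : rees F -> quot_ring _).

Lemma gr_proj_eq0 (p : rees F) :
  gr_proj F p = 0 <-> forall n : nat, F n.+1 (pol p)`_n.
Proof. exact: quot_ring_proj_eq0. Qed.

Lemma gr_projK (z : assoc_gr F) : exists p : rees F, z = gr_proj F p.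
Proof. by exists (repr z); rewrite /gr_proj /quot_ring_proj reprK. Qed.

Lemma gr_plus_coef0 z :
  gr_plus F z -> exists2 p : rees F, z = gr_proj F p & (pol p)`_0 = 0.
Proof.
apply: (@ideal_gen_min _ _
  [set z | exists2 p : rees F, z = gr_proj F p & (pol p)`_0 = 0]).
  split=> [|c _ _ [p -> p0] [q -> q0]].
    by exists 0; rewrite ?raddf0 ?coef0.
  have [e ->] := gr_projK c; exists (e * p + q); first by rewrite rmorphD rmorphM.
  by rewrite rmorphD rmorphM /= coefD coef0M p0 q0 mulr0 addr0.
move=> _ [n n0 [p [y [py ->]]]]; exists p => //.
by rewrite py coefZ coefXn; case: n n0 {py} => // n _; rewrite mulr0.
Qed.

Variables (d : nat) (x : 'I_d -> R).
Hypothesis Fx : forall j, F 1 (x j).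
Implicit Types (S T U : {set 'I_d}).

(** The class of [x j] in degree 1 of [G(F)]. *)
Definition gr_form (j : 'I_d) : assoc_gr F := gr_proj F (rees_of (x j *: 'X)).

Lemma val_rees_form j : pol (rees_of (x j *: 'X)) = x j *: 'X.
Proof. exact: val_rees_mono (Fx j). Qed.

(** A lift [p] of [z] without constant term has a power [p ^+ N.+1] with no coefficient in degrees
    up to [N]; every coefficient above is a combination of the [x j] by hypothesis. *)
Lemma gr_plus_radical (N : nat) z :
  (forall (k : nat) y, (N <= k)%N -> F k.+1 y ->
    exists v : 'I_d -> R, (forall j, F k (v j)) /\ y = \sum_j x j * v j) ->
  gr_plus F z -> in_radical_of gr_form z.
Proof.
move=> FN /gr_plus_coef0[p -> p0].
have pN k n : (n < k)%N -> (pol (p ^+ k))`_n = 0.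
  rewrite rmorphXn /=; elim: k n => [//|k IH] n nk.
  rewrite exprS coefM big_ord_recl /= p0 mul0r add0r big1 // => i _.
  by rewrite IH ?mulr0 //= /bump; have := ltn_ord i; lia.
pose q := pol (p ^+ N.+1).
have /choice[v vP] : forall k : nat, exists v : 'I_d -> R,
    (forall j, F k (v j)) /\ q`_k.+1 = \sum_j x j * v j.
  move=> k; have [Nk|kN] := leqP N k; first by apply: FN => //; exact: rees_coef.
  exists (fun=> 0); split=> [j|]; first exact: fil0.
  by rewrite /q pN // big1 // => j _; rewrite mulr0.
(* The cofactors of each coefficient of [q], assembled one degree lower. *)
pose u j : {poly R} := \poly_(k < size q) v k j.
have Fu j (k : nat) : F k (u j)`_k.
  by rewrite coef_poly; case: ifP => _; [exact: (vP k).1|exact: fil0].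
exists N.+1, (fun j => gr_proj F (rees_of (u j))).
rewrite -rmorphXn; under eq_bigr => j _ do rewrite -rmorphM.
rewrite -rmorph_sum; congr gr_proj; apply: val_inj; rewrite rmorph_sum.
apply/polyP => k; rewrite coef_sum -/q.
under eq_bigr => j _ do
  rewrite rmorphM /= val_rees_form (val_rees_of (Fu j)) -scalerAl coefZ coefXM.
case: k => [|k] /=; first by rewrite /q pN // big1 // => j _; rewrite mulr0.
have [kq|qk] := ltnP k (size q).
  by rewrite (vP k).2; apply: eq_bigr => j _; rewrite coef_poly kq.
rewrite nth_default ?(leq_trans qk) // big1 // => j _.
by rewrite coef_poly ltnNge qk /= mulr0.
Qed.

(* Homogeneous components of the exactness of the Koszul complex over [G(F)]. *)
Lemma fil_koszul_exact i (n : int) (a : {set 'I_d} -> R) :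
  koszul_exact gr_form [set 0] i.+1 ->
  (forall S, F (n - #|S|%:Z) (a S)) ->
  (forall T, (i <= #|T|)%N -> F (n - #|T|%:Z + 1) (koszul_diff x a T)) ->
  exists w : {set 'I_d} -> R, (forall U, F (n - #|U|%:Z) (w U)) /\
    forall S, (i < #|S|)%N -> F (n - #|S|%:Z + 1) (a S - koszul_diff x w S).
Proof.
move=> ex Fa Fda; case: n Fa Fda => [n|n] Fa Fda; last first.
  by exists (fun=> 0); split=> [U|S _]; apply: fil_nonpos; lia.
pose r S := rees_of (a S *: 'X^(n - #|S|)).
(* The coordinate at [S] is placed in degree [n - #|S|]. For [#|S| > n] this degree is negative and
   the component of [G(F)] there is zero, whereas truncated subtraction would give degree 0. *)
pose alpha S : rees F := if (#|S| <= n)%N then r S else 0.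
have val_alpha S : pol (alpha S) =
    if (#|S| <= n)%N then a S *: 'X^(n - #|S|) else 0.
  rewrite /alpha; case: ifP => Sn //; apply: val_rees_mono.
  by have := Fa S; rewrite subzn.
have val_diff (p : {set 'I_d} -> rees F) T k :
    (pol (koszul_diff (fun j => rees_of (x j *: 'X)) p T))`_k =
    if k is l.+1 then koszul_diff x (fun S => (pol (p S))`_l) T else 0.
  rewrite -(coef_koszul_diff x (fun S => pol (p S))); congr (polyseq _)`_k.
  rewrite rmorph_koszul_diff /koszul_diff; apply: eq_bigr => j _ /=.
  by rewrite val_rees_form.
have [T iT|w0 w0P] := ex (gr_proj F \o alpha).
  have <- : gr_proj F (koszul_diff (fun j => rees_of (x j *: 'X)) alpha T) =
      koszul_diff gr_form (gr_proj F \o alpha) T by rewrite rmorph_koszul_diff.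
  apply/gr_proj_eq0 => k; rewrite val_diff; case: k => [|k]; first exact: fil0.
  have [Tn|Tn] := leqP #|T|.+1 n; last first.
    rewrite koszul_diff_eq0 => [|S ST]; first exact: fil0.
    by rewrite val_alpha ifF ?coef0 //; lia.
  have [kE|kn] := eqVneq k (n - #|T|.+1)%N.
    rewrite (@eq_koszul_diff _ _ _ _ a); last first.
      by move=> S ST; rewrite val_alpha ST Tn coefZ coefXn kE eqxx mulr1.
    have -> : Posz k.+2 = Posz n - #|T|%:Z + 1 by lia.
    by apply: Fda; lia.
  rewrite koszul_diff_eq0 => [|S ST]; first exact: fil0.
  by rewrite val_alpha ST Tn coefZ coefXn (negPf kn) mulr0.
have /choice[p pE] : forall U, exists p : rees F, w0 U = gr_proj F p.
  by move=> U; exact: gr_projK.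
(* The bounding chain over [G(F)] need not be homogeneous; only its component of total degree [n] is
   kept. *)
pose w U := if (#|U| <= n)%N then (pol (p U))`_(n - #|U|) else 0.
exists w; split=> [U|S iS].
  rewrite /w; case: ifP => Un; last exact: fil0.
  by rewrite subzn //; exact: rees_coef.
have [Sn|nS] := leqP #|S| n; last by apply: fil_nonpos; lia.
have /gr_proj_eq0/(_ (n - #|S|)%N) : gr_proj F (alpha S -
    koszul_diff (fun j => rees_of (x j *: 'X)) p S) = 0.
  rewrite raddfB /= rmorph_koszul_diff.
  have := w0P S iS; rewrite (@eq_koszul_diff _ _ _ _ (gr_proj F \o p)) //.
rewrite raddfB /= coefB val_diff val_alpha Sn coefZ coefXn eqxx mulr1.
have -> : Posz n - #|S|%:Z + 1 = (n - #|S|).+1 by lia.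
congr (F _ (_ - _)).
case nS : (n - #|S|)%N => [|k].
  by rewrite koszul_diff_eq0 // => U US; rewrite /w ifF //; lia.
apply: eq_koszul_diff => U US; rewrite /w ifT; last by lia.
by congr (_`_ _); lia.
Qed.

End Rees.

(** * The Koszul complex and the filtration *)

Section KoszulFiltration.
Variables (R : comNzRingType) (I : set R) (F : filtration I) (d : nat).
Variables (x : 'I_d -> R) (r : int).
Implicit Types (S T U : {set 'I_d}) (u w a : {set 'I_d} -> R^o) (n : int).

Hypothesis Fx : forall j, F 1 (x j).
Hypothesis exG : koszul_exact (gr_form F x) [set 0] 2.
Hypothesis exR : koszul_exact x [set 0] 1.
Hypothesis stab : forall n y, r <= n -> F (n + 1) y ->
  exists v : 'I_d -> R, (forall j, F n (v j)) /\ y = \sum_j x j * v j.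

Lemma koszul_diff_set0 a :
  koszul_diff x a finset.set0 = \sum_j x j * a [set j]%SET.
Proof.
rewrite /koszul_diff; apply: eq_big => [j|j _]; first by rewrite inE.
by rewrite koszul_sign0 mul1r finset.setU0.
Qed.

Lemma koszul_diff_fil n u T :
  (forall S, #|S| = #|T|.+1 -> F n (u S)) -> F (n + 1) (koszul_diff x u T).
Proof.
move=> Fu; apply: fil_sum => j jT; rewrite -mulrA mulrCA addrC.
apply: filM (Fx j) _; apply: (idealM (fil_ideal F n)); apply: Fu.
by rewrite cardsU1 jT.
Qed.

(* The class of a Koszul 1-cycle of [G(F)] lifts to a Koszul 1-cycle of [R],
   hence to a boundary [koszul_diff x w]; exactness over [G(F)] pushes [w] up the
   filtration one step at a time. *)
Lemma koszul_cycle_lift n a : r <= n ->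
  (forall S, F (n - #|S|%:Z) (a S)) ->
  (forall T, F (n - #|T|%:Z + 1) (koszul_diff x a T)) ->
  exists w, (forall U, F (n - #|U|%:Z) (w U)) /\
    forall S, (0 < #|S|)%N -> F (n - #|S|%:Z + 1) (a S - koszul_diff x w S).
Proof.
move=> rn Fa Fda.
have [w0 [Fw0 w0P]] := fil_koszul_exact Fx exG Fa (fun T _ => Fda T).
(* Same boundary as [a], but one step deeper in the filtration in homological degrees at least 2. *)
pose a1 S := a S - koszul_diff x w0 S.
have Fa1 S : F (n - #|S|%:Z) (a1 S).
  apply: filD; first exact: Fa.
  apply: filN; have -> : n - #|S|%:Z = (n - #|S|.+1%:Z) + 1 by lia.
  by apply: koszul_diff_fil => U <-.
have da1 T : koszul_diff x a1 T = koszul_diff x a T.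
  by rewrite koszul_diffB koszul_diff_diff subr0.
(* The boundary at the empty set lies in [F (n + 1)], which is [J] times [F n] because [r <= n]. The
   [b j] are in [F n], hence negligible in homological degree 1, and subtracting them turns the
   degree 1 part of [a1] into a true cycle [a2] over [R]. *)
have [b [Fb bE]] : exists b : 'I_d -> R, (forall j, F n (b j)) /\
    koszul_diff x a1 finset.set0 = \sum_j x j * b j.
  apply: stab rn _; rewrite da1; have := Fda finset.set0.
  by rewrite cards0 subr0.
pose a2 S := if #|S| == 1%N then a1 S - \sum_(j in S) b j else 0.
have Fa2 S : F (n - #|S|%:Z) (a2 S).
  rewrite /a2; case: ifP => S1; last exact: fil0.
  apply: filD (Fa1 S) _; apply: filN; apply: fil_sum => j _.
  by apply: fil_le (Fb j); lia.
have da2 T : koszul_diff x a2 T = 0.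
  have [->|/set0Pn[j jT]] := eqVneq T finset.set0; last first.
    apply: koszul_diff_eq0 => S ST; rewrite /a2 ST eqSS ifF //.
    by rewrite (cardsD1 j) jT.
  rewrite koszul_diff_set0; rewrite koszul_diff_set0 in bE.
  under eq_bigr => j _ do rewrite /a2 cards1 eqxx big_set1 mulrBr.
  by rewrite sumrB bE subrr.
have [w1 w1P] := exR (a := a2) (fun T _ => da2 T).
(* At [p = 0] the filtration condition is void. While [p < n], the boundary [a2] of [w] is deep
   enough for [w] to be a cycle of [G(F)] in degrees at least 2, and subtracting a boundary raises
   its filtration degree. *)
have main (p : nat) : p%:Z <= n -> exists w, (forall U, F (p%:Z - #|U|%:Z) (w U)) /\
    forall S, (0 < #|S|)%N -> koszul_diff x w S = a2 S.
  elim: p => [_|p IH pn].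
    exists w1; split=> [U|S S0]; first by apply: fil_nonpos; lia.
    by apply/esym/subr0_eq; exact: w1P.
  have [|w [Fw wa2]] := IH; first by lia.
  have [T T0|v [Fv vP]] := fil_koszul_exact Fx exG Fw.
    by rewrite wa2 //; apply: fil_le (Fa2 T); lia.
  exists (fun U => if (1 < #|U|)%N then w U - koszul_diff x v U else 0).
  split=> [U|S S0].
    case: ifP => U1; last exact: fil0.
    by have := vP U U1; congr (F _ _); lia.
  rewrite -wa2 // -[RHS]subr0 -(koszul_diff_diff x v S) -koszul_diffB.
  by apply: eq_koszul_diff => U US; rewrite US ltnS S0.
have [w [Fw wP]] : exists w, (forall U, F (n - #|U|%:Z) (w U)) /\
    forall S, (0 < #|S|)%N -> koszul_diff x w S = a2 S.
  case: (n) main => [p main|p _]; first exact: main.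
  exists w1; split=> [U|S S0]; first by apply: fil_nonpos; lia.
  by apply/esym/subr0_eq; exact: w1P.
exists (fun U => w0 U + w U); split=> [U|S S0]; first exact: filD.
rewrite koszul_diffD wP // opprD addrA -/(a1 S) /a2.
case: ifP => [/eqP S1|S1].
  rewrite subKr; apply: fil_sum => j _; apply: fil_le (Fb j); lia.
by rewrite subr0; apply: w0P; lia.
Qed.

(** * Euler characteristic of a graded strand *)

Section Herbrand.
Variable n : int.

(* The graded pieces of the Koszul complex of [G(F)] in internal degree [n], summed
   over the homological degrees of parity [e], are [cochains e] modulo
   [denominators]. *)
Definition cochains (e : bool) : set ({set 'I_d} -> R^o) :=
  [set u | forall S, F (n - #|S|%:Z + (odd #|S| != e)%:Z) (u S)].

Definition denominators : set ({set 'I_d} -> R^o) :=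
  [set u | forall S, F (n - #|S|%:Z + 1) (u S)].

Definition cycles e : set ({set 'I_d} -> R^o) :=
  [set u | cochains e u /\ denominators (koszul_diff x u)].

Definition boundaries e : set ({set 'I_d} -> R^o) :=
  [set u | exists2 w, cochains (~~ e) w & denominators (u - koszul_diff x w)].

(** As [mod_length] is 0 on modules of infinite length, this records that the values of the Hilbert
    function are genuine lengths. *)
Hypothesis hilb : forall k : int,
  @has_length R R^o (F (k + 1)) (F k) (hilbert_fun F k).

Lemma cochains_submod e : is_submod (cochains e).
Proof.
split=> [S|c u w Cu Cw S]; first exact: fil0.
exact: (fil_ideal F _).2 (Cu S) (Cw S).
Qed.

Lemma denominators_submod : is_submod denominators.
Proof.
split=> [S|c u w Cu Cw S]; first exact: fil0.
exact: (fil_ideal F _).2 (Cu S) (Cw S).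
Qed.

Lemma denominators_cochains e : denominators `<=` cochains e.
Proof. by move=> u Du S; apply: fil_le (Du S); case: (_ != _); lia. Qed.

Lemma koszul_diff_cochains e u : cochains e u -> cochains (~~ e) (koszul_diff x u).
Proof.
move=> Cu T; have -> : n - #|T|%:Z + (odd #|T| != ~~ e)%:Z =
    n - #|T|.+1%:Z + (odd #|T|.+1 != e)%:Z + 1.
  by rewrite oddS; case: (odd _); case: (e); lia.
by apply: koszul_diff_fil => S <-; exact: Cu.
Qed.

Lemma koszul_diff_denominators u : denominators u -> denominators (koszul_diff x u).
Proof.
move=> Du T; have -> : n - #|T|%:Z + 1 = n - #|T|.+1%:Z + 1 + 1 by lia.
by apply: koszul_diff_fil => S <-; exact: Du.
Qed.

Lemma koszul_diff_linear c u w :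
  koszul_diff x (c *: u + w) =
  c *: (koszul_diff x u : {set 'I_d} -> R^o) + koszul_diff x w.
Proof.
apply/funext => T; rewrite -[LHS]/(koszul_diff x (fun S => c * u S + w S) T).
by rewrite koszul_diffD koszul_diffZ.
Qed.

Lemma cycles_submod e : is_submod (cycles e).
Proof.
have [C0 Clin] := cochains_submod e; have [D0 Dlin] := denominators_submod.
split=> [|c u w [Cu Du] [Cw Dw]].
  by split=> //; apply: koszul_diff_denominators.
by split; [exact: Clin|rewrite koszul_diff_linear; exact: Dlin].
Qed.

Lemma boundaries_submod e : is_submod (boundaries e).
Proof.
have [C0 Clin] := cochains_submod (~~ e); have [D0 Dlin] := denominators_submod.
split=> [|c u w [u' Cu Du] [w' Cw Dw]].
  exists 0 => //; apply: (submodB denominators_submod) => //.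
  exact: koszul_diff_denominators.
exists (c *: u' + w'); first exact: Clin.
have -> : c *: u + w - koszul_diff x (c *: u' + w') =
    c *: (u - koszul_diff x u') + (w - koszul_diff x w').
  by rewrite koszul_diff_linear scalerBr opprD addrACA.
exact: Dlin.
Qed.

Lemma denominators_boundaries e : denominators `<=` boundaries e.
Proof.
move=> u Du; exists 0; first exact: (submod0 (cochains_submod _)).
apply: (submodB denominators_submod) => //.
by apply: koszul_diff_denominators; exact: (submod0 denominators_submod).
Qed.

Lemma boundaries_cycles e : boundaries e `<=` cycles e.
Proof.
move=> u [w Cw Dw]; split.
  rewrite -[u](subrK (koszul_diff x w : {set 'I_d} -> R^o)).
  apply: (submodD (cochains_submod _)); first exact: denominators_cochains.
  by rewrite -[e]negbK; exact: koszul_diff_cochains.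
move=> T; have := koszul_diff_denominators Dw T.
rewrite -[koszul_diff x (u - _)]/(koszul_diff x (fun S => u S - koszul_diff x w S)).
by rewrite koszul_diffB koszul_diff_diff subr0.
Qed.

Definition parity_sum (e : bool) : nat :=
  (\sum_(S : {set 'I_d}) if odd #|S| == e then hilbert_fun F (n - #|S|%:Z) else 0)%N.

Lemma has_length_cochains e : has_length denominators (cochains e) (parity_sum e).
Proof.
apply: (@has_length_prod R R^o _ (fun S => F (n - #|S|%:Z + 1))
  (fun S => F (n - #|S|%:Z + (odd #|S| != e)%:Z))) => S; try exact: fil_ideal.
  by move=> y; apply: fil_le; case: (_ != _); lia.
case: eqP => _ /=; last exact/has_length_refl/fil_ideal.
by rewrite addr0; exact: hilb.
Qed.

(* Herbrand quotient: the lengths of the images of the differentials cancel in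
   the difference of the lengths of the even and of the odd cochains. *)
Lemma koszul_euler : exists c0 c1,
  [/\ has_length (boundaries false) (cycles false) c0,
      has_length (boundaries true) (cycles true) c1 &
      (parity_sum false + c1 = parity_sum true + c0)%N].
Proof.
have split3 e : exists b c z, [/\ has_length denominators (boundaries e) b,
    has_length (boundaries e) (cycles e) c,
    has_length denominators (boundaries (~~ e)) z &
    parity_sum e = (b + c + z)%N].
  have [] := has_length_split denominators_submod (cycles_submod e) _ _
    (cochains_submod e) (has_length_cochains e).
  - by move=> u /(@denominators_boundaries e)/boundaries_cycles.
  - by move=> u [].
  move=> bc [z [hE lenbc lenz]].
  have [b [c [bcE lenb lenc]]] := has_length_split denominators_submod
    (boundaries_submod e) (@denominators_boundaries e) (@boundaries_cycles e)
    (cycles_submod e) lenbc.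
  exists b, c, z; split=> //; last by rewrite hE bcE.
  (* The differential identifies cochains modulo cycles with the boundaries of the opposite
     parity. *)
  suff tr : forall l, has_length (cycles e) (cochains e) l <->
    has_length denominators (boundaries (~~ e)) l by exact/tr.
  apply: (@has_length_transfer R ({set 'I_d} -> R^o) ({set 'I_d} -> R^o)
    (koszul_diff x) (cycles e) (cochains e)).
  - exact: koszul_diff_linear.
  - exact: cochains_submod.
  - by move=> u [].
  - exact: denominators_submod.
  - exact: boundaries_submod.
  - exact: denominators_boundaries.
  - move=> u Cu; exists u; first by rewrite negbK.
    by rewrite subrr; exact: (submod0 denominators_submod).
  - by move=> u Cu; split=> [Du|[]].
  - by move=> v [w Cw Dw]; exists w => //; rewrite -[e]negbK.
have [b0 [c0 [z0 [lenb0 lenc0 lenz0 h0]]]] := split3 false.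
have [b1 [c1 [z1 [lenb1 lenc1 lenz1 h1]]]] := split3 true.
exists c0, c1; split=> //; rewrite h0 h1.
by rewrite (max_chain_length_inj lenz0 lenb1) (max_chain_length_inj lenz1 lenb0); lia.
Qed.

(** [koszul_cycle_lift] bounds the cycle in all positive degrees; the even coordinates of its
    witness suffice at odd [S]. *)
Lemma cycles_odd_boundaries : r <= n -> cycles true `<=` boundaries true.
Proof.
move=> rn a [Ca Da].
have Fa S : F (n - #|S|%:Z) (a S) by apply: fil_le (Ca S); case: (_ != _); lia.
have [w [Fw wP]] := koszul_cycle_lift rn Fa Da.
exists (fun U => if odd #|U| then 0 else w U) => [U|S].
  case: ifP => oU; first exact: fil0.
  by rewrite /= addr0.
rewrite -[(a - _) S]/(a S - koszul_diff x _ S).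
have [oS|eS] := boolP (odd #|S|).
  rewrite (@eq_koszul_diff _ _ _ _ w); first by apply: wP; case: #|S| oS.
  by move=> U ->; rewrite oddS oS.
rewrite koszul_diff_eq0 => [|U ->]; last by rewrite oddS eS.
by rewrite subr0; have := Ca S; rewrite (negPf eS).
Qed.

(** Exactness over [G(F)] handles positive even degrees. In degree 0, [F n] is [J] times
    [F (n - 1)]; the strict inequality is what makes [n - 1] at least [r]. *)
Lemma cycles_even_boundaries : r < n -> cycles false `<=` boundaries false.
Proof.
move=> rn a [Ca Da].
have Fa S : F (n - #|S|%:Z) (a S) by apply: fil_le (Ca S); case: (_ != _); lia.
have [w [Fw wP]] := fil_koszul_exact Fx exG Fa (fun T _ => Da T).
have [b [Fb bE]] : exists b : 'I_d -> R, (forall j, F (n - 1) (b j)) /\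
    a finset.set0 = \sum_j x j * b j.
  apply: stab; first by lia.
  by have := Ca finset.set0; rewrite cards0 subr0 addr0 subrK.
(* The two bounding chains do not interfere: singletons affect only the empty set, and an even
   nonempty [S] sees only sets of size at least 3. *)
exists (fun U => if #|U| == 1%N then \sum_(j in U) b j
                 else if odd #|U| then w U else 0) => [U|S].
  case: ifP => [/eqP U1|_].
    by apply: fil_sum => j _; rewrite U1 addr0; exact: Fb.
  case: ifP => oU; last exact: fil0.
  by rewrite /= addr0.
rewrite -[(a - _) S]/(a S - koszul_diff x _ S).
have [->|/set0Pn[j jS]] := eqVneq S finset.set0.
  rewrite koszul_diff_set0 bE [X in F _ (_ - X)](eq_bigr (fun j => x j * b j)).
    by rewrite subrr; exact: fil0.
  by move=> j _; rewrite cards1 eqxx big_set1.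
have S0 : (0 < #|S|)%N by rewrite (cardsD1 j) jS.
have [oS|eS] := boolP (odd #|S|); last first.
  rewrite (@eq_koszul_diff _ _ _ _ w); first by apply: wP; case: #|S| S0 eS => [|[]].
  by move=> U ->; rewrite oddS eS eqSS ifF //; lia.
rewrite koszul_diff_eq0 => [|U ->]; last by rewrite oddS oS eqSS ifF //; lia.
by rewrite subr0; have := Ca S; rewrite oS.
Qed.

End Herbrand.

(** Any [y] in [F n], placed at the empty set, is an even cycle; reading off a bounding chain there
    puts [y] in [J] times [F (n - 1)] plus [F (n + 1)]. *)
Lemma cycles_even_not_boundaries n y : F n y ->
  cycles n false `<=` boundaries n false ->
  exists v : 'I_d -> R, (forall j, F (n - 1) (v j)) /\
    F (n + 1) (y - \sum_j x j * v j).
Proof.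
move=> Fy ZB; pose a S : R^o := if S == finset.set0 then y else 0.
have [|w Cw Dw] := ZB a.
  split=> [S|T].
    rewrite /a; have [->|_] := eqVneq S finset.set0; last exact: fil0.
    by rewrite cards0 subr0 addr0.
  rewrite koszul_diff_eq0 => [|S ST]; first exact: fil0.
  by rewrite /a ifF //; apply: contra_eqF ST => /eqP->; rewrite cards0.
exists (fun j => w [set j]%SET); split=> [j|].
  by have := Cw [set j]%SET; rewrite cards1 addr0.
have := Dw finset.set0; rewrite -[(a - _) _]/(a finset.set0 - koszul_diff x _ _).
by rewrite koszul_diff_set0 /a eqxx cards0 subr0.
Qed.

End KoszulFiltration.

(** * Finite differences of the Hilbert function *)

Section AlternatingSum.
Variable d : nat.

(** The [d]-th backward difference of [f]. Summing over subsets, as in the Koszul complex, replaces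
    the binomial coefficients. *)
Definition alternating_sum (f : int -> rat) (n : int) : rat :=
  \sum_(S : {set 'I_d}) (-1) ^+ #|S| * f (n - #|S|%:Z).

(** The difference of a polynomial is again a polynomial; having all integers from [N] on as roots,
    it is zero. *)
Lemma alternating_sum_poly (Q : {poly rat}) (N : int) :
  (forall n : int, N <= n -> alternating_sum (fun k => Q.[k%:~R]) n = 0) ->
  forall n : int, alternating_sum (fun k => Q.[k%:~R]) n = 0.
Proof.
move=> Q0.
pose D := \sum_(S : {set 'I_d}) (-1) ^+ #|S| *: (Q \Po ('X - (#|S|%:R)%:P)).
have DE n : D.[n%:~R] = alternating_sum (fun k => Q.[k%:~R]) n.
  rewrite horner_sum; apply: eq_bigr => S _.
  by rewrite hornerZ horner_comp hornerXsubC rmorphB.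
suff D0 : D = 0 by move=> n; rewrite -DE D0 horner0.
apply: (roots_geq_poly_eq0 (rs := [seq (N + i%:Z)%:~R | i <- iota 0 (size D)])).
- by apply/allP => _ /mapP[i _ ->]; rewrite /root DE Q0 // lerDl.
- rewrite map_inj_uniq ?iota_uniq // => i j /eqP.
  by rewrite eqr_int => /eqP/addrI[].
- by rewrite size_map size_iota.
Qed.

Lemma alternating_sum_last f (n : int) : (forall k, n < k -> f k = 0) ->
  alternating_sum f (n + d%:Z) = (-1) ^+ d * f n.
Proof.
move=> f0; rewrite /alternating_sum (bigD1 [set: 'I_d]%SET) //= cardsT card_ord addrK.
rewrite big1 ?addr0 // => S ST; rewrite f0 ?mulr0 //.
rewrite -addrA ltrDl subr_gt0 ltz_nat -[ltnRHS]card_ord -cardsT.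
by rewrite proper_card // properT.
Qed.

(** Descending induction: once [f] vanishes above [n], its difference at [n + d] is [f n] up to
    sign. *)
Lemma alternating_sum_eq0 f (N r : int) : (forall n, N <= n -> f n = 0) ->
  (forall n, r < n -> alternating_sum f n = 0) ->
  forall n, r - d%:Z < n -> f n = 0.
Proof.
move=> fN fr n; have [k] : exists k : nat, N - k%:Z <= n.
  by exists `|N - n|%N; lia.
elim: k n => [|k IH] n Nn rn; first by apply: fN; lia.
have : alternating_sum f (n + d%:Z) = 0 by apply: fr; lia.
rewrite alternating_sum_last => [/eqP|l nl]; last by apply: IH; lia.
by rewrite mulf_eq0 signr_eq0 => /eqP.
Qed.

End AlternatingSum.

Lemma alternating_sum_parity (R : comNzRingType) (I : set R) (F : filtration I)
    d (n : int) :
  alternating_sum d (fun k => (hilbert_fun F k)%:R) n =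
  (parity_sum F d n false)%:R - (parity_sum F d n true)%:R.
Proof.
rewrite /parity_sum !natr_sum -sumrB; apply: eq_bigr => S _.
by rewrite -signr_odd; case: (odd _); rewrite /= ?sub0r ?subr0 ?mulN1r ?mul1r.
Qed.

(** * Products of ideals *)

Section IdealProducts.
Variable A : comPzRingType.
Implicit Types (a b c : set A).

Lemma ideal_mul_sub a b c : is_ideal c ->
  (forall y z, a y -> b z -> c (y * z)) -> ideal_mul a b `<=` c.
Proof.
by move=> ic abc; apply: ideal_gen_min => // _ [y [z [ay bz ->]]]; exact: abc.
Qed.

Lemma mem_ideal_mul a b y z : a y -> b z -> ideal_mul a b (y * z).
Proof. by move=> ay bz; apply: ideal_gen_sub; exists y, z. Qed.

Lemma ideal_expz_exp a (k : nat) y : a y -> ideal_expz a k (y ^+ k).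
Proof.
move=> ay; elim: k => [//|k IH]; rewrite exprS; exact: mem_ideal_mul.
Qed.

(** The combinations of the [x j] with coefficients in [b] form an ideal [V]; for fixed [z] in [b],
    the [u] with [u * z] in [V] form an ideal containing each [x j]. *)
Lemma ideal_mul_tuple d (x : d.-tuple A) b y : is_ideal b ->
  ideal_mul (ideal_gen [set` x]) b y ->
  exists v : 'I_d -> A, (forall j, b (v j)) /\ y = \sum_j tnth x j * v j.
Proof.
move=> ib; pose V : set A := [set y | exists v : 'I_d -> A, (forall j, b (v j)) /\
  y = \sum_j tnth x j * v j].
have iV : is_ideal V.
  split.
    exists (fun=> 0); split=> [j|]; first exact: (submod0 ib).
    by rewrite big1 // => j _; rewrite mulr0.
  move=> c _ _ [v [bv ->]] [w [bw ->]]; exists (fun j => c * v j + w j).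
  split=> [j|]; first exact: ib.2 (bv j) (bw j).
  rewrite /GRing.scale /= mulr_sumr -big_split; apply: eq_bigr => j _ /=.
  by rewrite mulrDr mulrCA.
suff : ideal_mul (ideal_gen [set` x]) b `<=` V by apply.
apply: ideal_mul_sub => // u z Ju bz; move: Ju.
apply: (@ideal_gen_min _ _ [set u | V (u * z)]).
  split; first by rewrite /= mul0r; exact: (submod0 iV).
  move=> c y1 y2 Vy1 Vy2 /=.
  have -> : (c *: (y1 : A^o) + y2) * z = c *: (y1 * z : A^o) + y2 * z.
    by rewrite /GRing.scale /= mulrDl mulrA.
  exact: iV.2.
move=> _ /tnthP[i ->]; exists (fun j => if j == i then z else 0); split=> [j|].
  by case: eqP => _ //; exact: (submod0 ib).
by rewrite (bigD1 i) //= eqxx big1 ?addr0 // => j /negPf->; rewrite mulr0.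
Qed.

End IdealProducts.

(** * Comparison of the Hilbert function with the Hilbert polynomial *)

Theorem theorem1p14 (R : comNzRingType) (m : ideal R) (d : nat)
    (I : set R) (F : filtration I) (P : {poly rat}) (g : nat)
    (J : set R) (x : d.-tuple R) (r : int) :
  @local_ring R m ->
  @cohen_macaulay R m ->
  krull_dim R d ->
  (1 <= d)%N ->
  infinite_set [set: quot_ring m] ->
  @primary_to R m I ->
  admissible F ->
  is_hilbert_poly F P ->
  is_grade (gr_plus F) g ->
  (d - 1 <= g)%N ->
  is_minimal_reduction F J ->
  J = ideal_gen [set` x] ->
  is_reduction_number F J r ->
  (hilbert_fun F (r - d%:Z))%:R <> P.[(r - d%:Z)%:~R] /\
  (forall n : int, r - d%:Z + 1 <= n -> (hilbert_fun F n)%:R = P.[n%:~R]).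

Proof.
move=> [noeth maxm _] CM dimR _ _ [_ radI] _ [N0 PN] [[s [[sreg _] sG sg]] _] dg.
move=> [[iJ JF1 _] _] JE [stable rmin].
have JFmul n y : r <= n -> F (n + 1) y ->
    exists v : 'I_d -> R, (forall j, F n (v j)) /\ y = \sum_j tnth x j * v j.
  move=> rn; rewrite -stable // JE; exact/ideal_mul_tuple/fil_ideal.
have Jx j : J (tnth x j) by rewrite JE; apply: ideal_gen_sub; exact: mem_tnth.
have Fx j : F 1 (tnth x j) by exact: JF1.
have mF n z : submodule_set m z -> exists k, F n (z ^+ k).
  rewrite -radI => -[k Izk]; case: n => [n|n]; last by exists 0%N; exact: fil_nonpos.
  by exists (k * n)%N; rewrite exprM; apply: fil_exp; exact: ideal_expz_exp.
have exG : koszul_exact (gr_form F (tnth x)) [set 0] 2.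
  apply: (koszul_depth_sensitivity sreg) => [z /sG zG|]; last by rewrite sg; lia.
  apply: (gr_plus_radical Fx (N := `|r|%N)) zG => k y rk Fy.
  by apply: JFmul; [lia|rewrite -PoszD addn1].
(* Cohen-Macaulayness provides a regular sequence of length [d] in [m]. Each of its elements has a
   power in [F (r + 1)], which is [J] times [F r], so it is in the radical of the [x j]. *)
have exR : koszul_exact (tnth x) [set 0] 1.
  have [d' [dimR' [[s' [[s'reg _] s'm s'd]] _]]] := CM.
  have dd' := max_chain_length_inj dimR dimR'.
  apply: (koszul_depth_sensitivity s'reg) => [z /s'm mz|]; last by rewrite s'd; lia.
  have [k Fzk] := mF (r + 1) z mz.
  by have [v [_ zE]] := JFmul r _ (lexx r) Fzk; exists k, v.
have hilb (n : int) : @has_length R R^o (F (n + 1)) (F n) (hilbert_fun F n).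
  have FS : F (n + 1) `<=` F n by apply: fil_anti; lia.
  have [l len] : exists l, @has_length R R^o (F (n + 1)) setT l.
    apply: has_length_primary noeth maxm (fil_ideal F _) _ => z mz.
    exact: mF.
  have sT : @is_submod R R^o setT by [].
  have [p [q [_ lenp _]]] := has_length_split (fil_ideal F _) (fil_ideal F _) FS
    (@subsetT _ _) sT len.
  by rewrite /hilbert_fun (mod_length_quot (N := fil_submod F n)
    (N' := fil_submod F (n + 1)) FS lenp).
pose h n : rat := (hilbert_fun F n)%:R; pose f n := h n - P.[n%:~R].
have f0 n : N0 <= n -> f n = 0 by move=> Nn; rewrite /f PN // subrr.
have altB g1 g2 n : alternating_sum d (fun k => g1 k - g2 k) n =
    alternating_sum d g1 n - alternating_sum d g2 n.
  by rewrite -sumrB; apply: eq_bigr => S _; rewrite mulrBr.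
have alt_euler n : r <= n -> exists c : nat,
    has_length (boundaries F (tnth x) n false) (cycles F (tnth x) n false) c /\
    alternating_sum d h n = c%:R.
  move=> rn; have [c0 [c1 [len0 len1 c01]]] := koszul_euler Fx n hilb.
  exists c0; split=> //; rewrite alternating_sum_parity.
  have Z1 := cycles_odd_boundaries Fx exG exR JFmul rn.
  have c10 : c1 = 0%N by exact: has_length_eq0 (boundaries_submod Fx n _) Z1 len1.
  by move: c01; rewrite c10 addn0 => ->; rewrite natrD addrC addKr.
have alt_h n : r < n -> alternating_sum d h n = 0.
  move=> rn; have [c [lenc ->]] := alt_euler n (ltW rn).
  have Z0 := cycles_even_boundaries Fx exG JFmul rn.
  by rewrite (has_length_eq0 (boundaries_submod Fx n _) Z0 lenc).
have alt_f n : alternating_sum d f n = alternating_sum d h n.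
  (* From [N0 + d] on, all arguments [k - #|S|] are at least [N0], where [P] agrees with [h]; from
     [r + 1] on, the difference of [h] vanishes. *)
  rewrite altB (@alternating_sum_poly d P (Num.max (N0 + d%:Z) (r + 1))) ?subr0 // => k.
  rewrite ge_max => /andP[Nk rk]; rewrite -(alt_h k); last by lia.
  apply: eq_bigr => S _; rewrite PN //; have := max_card S.
  by rewrite card_ord; lia.
have f_eq0 := alternating_sum_eq0 f0 (r := r)
  (fun n rn => etrans (alt_f n) (alt_h n rn)).
split=> [hP|n rn]; last by apply/subr0_eq/f_eq0; lia.
(* If [f] also vanished at [r - d], its difference at [r], which is [f (r - d)] up to sign, would be
   zero. *)
have alt0 : alternating_sum d h r = 0.
  have fk k : r - d%:Z < k -> f k = 0 by exact: f_eq0.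
  rewrite -alt_f -{1}(subrK d%:Z r) alternating_sum_last // /f /h hP subrr.
  by rewrite mulr0.
have [c [lenc]] := alt_euler r (lexx r); rewrite alt0 => /esym/eqP.
rewrite pnatr_eq0 => /eqP c0; rewrite {}c0 in lenc.
have ZB := has_length0_sub (boundaries_submod Fx r _) (cycles_submod Fx r _)
  (@boundaries_cycles _ _ _ _ _ Fx r _) lenc.
(* Vanishing even homology at [n = r] would make the filtration stable already from [r - 1], against
   the minimality of [r]. *)
suff /rmin : forall n, r - 1 <= n -> ideal_mul J (F n) = F (n + 1) by lia.
move=> n rn; have [/stable//|nr] := leP r n.
have {rn nr} -> : n = r - 1 by lia.
rewrite subrK; have iJF k : is_ideal (ideal_mul J (F k)) by exact: ideal_gen_ideal.
apply/seteqP; split=> y.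
  apply: ideal_mul_sub (fil_ideal F r) _ y => u v /JF1 Fu Fv.
  by have := filM Fu Fv; rewrite addrC subrK.
move=> Fy; have [v [Fv Fyv]] := cycles_even_not_boundaries Fy ZB.
(* The remainder lies in [F (r + 1)], which is [J] times [F r] and so is contained in [J] times
   [F (r - 1)]. *)
rewrite -[y](subrK (\sum_j tnth x j * v j)); apply: (submodD (iJF _)); last first.
  by apply: (submod_sum (iJF _)) => j _; exact: mem_ideal_mul.
move: Fyv; rewrite -stable //; apply: ideal_mul_sub => // u w Ju Fw.
by apply: mem_ideal_mul => //; apply: fil_le Fw; lia.
Qed.
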